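(* Let $S=\{r,r+1,\dots,n\}$ where $r$ and $n$ are integers with $r<n$, and let $\lambda\in H^*$ be such that $\mathrm{supp}(\lambda)\subset S$ and $\lambda\in P_+(S)$. Then $L(S,\lambda)$ belongs to the category $\mathcal{C}_{int}$. On the other hand, every irreducible $\mathfrak{gl}_\infty$-module in the category $\mathcal{C}_{int}$ is isomorphic to a module of this form (i.e. to $L(S,\lambda)$ for some such $S=\{r,r+1,\dots,n\}$, $r<n$, and some $\lambda\in P_+(S)$).
   Context: All vector spaces are over $\mathbb{C}$; $\mathbb{N}=\{0,1,2,\dots\}$. $\mathfrak{gl}_\infty$ is the Lie algebra of doubly infinite matrices (indexed by $\mathbb{Z}\times\mathbb{Z}$) with finitely many nonzero entries, with basis the matrix units $E_{m,n}$ ($m,n\in\mathbb{Z}$) and $[E_{m,n},E_{r,s}]=\delta_{n,r}E_{m,s}-\delta_{m,s}E_{r,n}$. $H=\mathrm{span}\{E_{n,n}: n\in\mathbb{Z}\}$. A $\mathfrak{gl}_\infty$-module is integrable if every $E_{n,n}$ acts semisimply and every $E_{p,q}$, $p\ne q$, acts locally nilpotently. $\mathcal{C}$ is the category of $\mathfrak{gl}_\infty$-modules $W$ such that for every $w\in W$ there is a finite subset $T\subset\mathbb{Z}$ with $E_{m,n}w=0$ for all $m,n\in\mathbb{Z}$ with $n\notin T$; $\mathcal{C}_{int}$ is the subcategory of integrable modules in $\mathcal{C}$. For a finite nonempty $S\subset\mathbb{Z}$ put $\mathfrak{gl}_S=\mathrm{span}\{E_{m,n}: m,n\in S\}$, $H_S=\mathrm{span}\{E_{n,n}:n\in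 S\}$, $\mathfrak{gl}_\infty^{(S,+)}=\mathrm{span}\{E_{m,n}: m\in\mathbb{Z},\ n\notin S\}$. For a $\mathfrak{gl}_S$-module $U$, let $\mathfrak{gl}_\infty^{(S,+)}$ act trivially on $U$, and set $M(S,U)=U(\mathfrak{gl}_\infty)\otimes_{U(\mathfrak{gl}_\infty^{(S,+)}+\mathfrak{gl}_S)}U$. If $U$ is irreducible, $M(S,U)$ has a unique irreducible quotient. For $\lambda\in H^*$, $\mathrm{supp}(\lambda)=\{m\in\mathbb{Z}:\lambda(E_{m,m})\neq 0\}$. If $\mathrm{supp}(\lambda)\subset S$, let $\lambda_S=\lambda|_{H_S}$ and let $L(\lambda_S)$ be the irreducible highest weight $\mathfrak{gl}_S$-module of highest weight $\lambda_S$ with respect to the positive part $\mathrm{span}\{E_{m,n}: m,n\in S,\ m<n\}$. $L(S,\lambda)$ is the irreducible quotient of $M(S,L(\lambda_S))$. $P_+(S)$ is the set of $\lambda\in H^*$ such that $\lambda(E_{i,i})\in\mathbb{N}$ for all $i\in\mathbb{Z}$, $\lambda(E_{i,i})=0$ whenever $i\notin S$, and $\lambda(E_{i,i})\ge\lambda(E_{j,j})$ for all $i,j\in S$ with $i<j$. *)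

(* Defs.v *)
From HB Require Import structures.
From mathcomp Require Import all_boot all_order all_algebra.
From mathcomp Require Import mathcomp_extra boolp classical_sets functions.
From mathcomp Require Import cardinality fsbigop set_interval reals.
From mathcomp Require Import complex ring.

Set Implicit Arguments.
Unset Strict Implicit.
Unset Printing Implicit Defensive.

Import Order.TTheory GRing.Theory Num.Theory.

Local Open Scope classical_set_scope.
Local Open Scope quotient_scope.
Local Open Scope ring_scope.

Section Span.
Variables (K : fieldType) (V : lmodType K).

Definition is_subspace (N : set V) : Prop :=
  N 0 /\ forall a x y, N x -> N y -> N (a *: x + y).

Definition span (X : set V) : set V :=
  [set v | forall N : set V, is_subspace N -> X `<=` N -> N v].

Definition sum_sub (M N : set V) : set V :=
  [set v | exists x y, [/\ M x, N y & v = x + y]].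

Lemma span_subspace X : is_subspace (span X).
Proof.
split=> [N [N0 _] _ //|a x y Xx Xy N NN XN].
by apply: NN.2; [exact: Xx | exact: Xy].
Qed.

Lemma sub_span X : X `<=` span X.
Proof. by move=> x Xx N _; exact. Qed.

Lemma is_subspace_sum (N : set V) I (s : seq I) (F : I -> V) :
  is_subspace N -> (forall i, N (F i)) -> N (\sum_(i <- s) F i).
Proof.
move=> [N0 NN] NF; elim/big_rec: _ => // i x _ Nx.
by rewrite -[F i]scale1r; apply: NN.
Qed.

End Span.

HB.mixin Record Lmodule_isLie (K : fieldType) L of GRing.Lmodule K L := {
  lie : L -> L -> L;
  lie_linearl : forall a x y z, lie (a *: x + y) z = a *: lie x z + lie y z;
  lie_linearr : forall a x y z, lie x (a *: y + z) = a *: lie x y + lie x z;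
  liexx : forall x, lie x x = 0;
  lie_jacobi : forall x y z,
    lie x (lie y z) + lie y (lie z x) + lie z (lie x y) = 0
}.

#[short(type="lieAlgType")]
HB.structure Definition LieAlgebra (K : fieldType) :=
  {L of GRing.Lmodule K L & Lmodule_isLie K L}.

Section LieTheory.
Variable K : fieldType.

Definition is_lie_hom (g h : lieAlgType K) (f : g -> h) : Prop :=
  (forall a x y, f (a *: x + y) = a *: f x + f y) /\
  (forall x y, f (lie x y) = lie (f x) (f y)).

Record subLie (g : lieAlgType K) := SubLie {
  sl_set :> set g;
  sl_subspace : is_subspace sl_set;
  sl_lie : forall x y, sl_set x -> sl_set y -> sl_set (lie x y)
}.

Section SubLieAlg.
Variables (g : lieAlgType K) (A : subLie g).

Definition sl_pred : {pred g} := fun x => `[< sl_set A x >].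

Lemma sl_predP x : reflect (sl_set A x) (x \in sl_pred).
Proof. exact: asboolP. Qed.

Lemma sl_pred_closed : subsemimod_closed sl_pred.
Proof.
have [A0 AA] := sl_subspace A.
split; first split; first exact/sl_predP.
- move=> x y /sl_predP Ax /sl_predP Ay; apply/sl_predP.
  by rewrite -[x]scale1r; apply: AA.
- move=> a x /sl_predP Ax; apply/sl_predP.
  by rewrite -[_ *: _]addr0; apply: AA.
Qed.

HB.instance Definition _ := GRing.isSubmodClosed.Build K g sl_pred sl_pred_closed.

Record sl_type := SlType { sl_val : g; sl_valP : sl_val \in sl_pred }.

HB.instance Definition _ := [isSub for sl_val].
HB.instance Definition _ := [Choice of sl_type by <:].
HB.instance Definition _ := [SubChoice_isSubLmodule of sl_type by <:].

Lemma sl_mem (x : sl_type) : sl_set A (sl_val x).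
Proof. exact/sl_predP/sl_valP. Qed.

Definition sl_mk x (Ax : sl_set A x) : sl_type := SlType (introT (sl_predP x) Ax).

Definition sl_bracket (x y : sl_type) : sl_type :=
  sl_mk (sl_lie (sl_mem x) (sl_mem y)).

Lemma sl_val_inj : injective sl_val. Proof. exact: val_inj. Qed.

Lemma sl_valD a x y : sl_val (a *: x + y) = a *: sl_val x + sl_val y.
Proof. exact: (linearP val). Qed.

Lemma sl_valDD x y : sl_val (x + y) = sl_val x + sl_val y.
Proof. exact: (raddfD val). Qed.

Lemma sl_val0 : sl_val 0 = 0. Proof. exact: (raddf0 val). Qed.

Fact sl_linearl a x y z :
  sl_bracket (a *: x + y) z = a *: sl_bracket x z + sl_bracket y z.
Proof. by apply: sl_val_inj; rewrite sl_valD /= -lie_linearl -sl_valD. Qed.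

Fact sl_linearr a x y z :
  sl_bracket x (a *: y + z) = a *: sl_bracket x y + sl_bracket x z.
Proof. by apply: sl_val_inj; rewrite sl_valD /= -lie_linearr -sl_valD. Qed.

Fact sl_bracketxx x : sl_bracket x x = 0.
Proof. by apply: sl_val_inj; rewrite sl_val0 /= liexx. Qed.

Fact sl_jacobi x y z : sl_bracket x (sl_bracket y z) +
  sl_bracket y (sl_bracket z x) + sl_bracket z (sl_bracket x y) = 0.
Proof.
apply: sl_val_inj; rewrite sl_val0 -(lie_jacobi (sl_val x) (sl_val y) (sl_val z)).
by rewrite !sl_valDD.
Qed.

HB.instance Definition _ :=
  Lmodule_isLie.Build K sl_type sl_linearl sl_linearr sl_bracketxx sl_jacobi.

Definition sl_alg : lieAlgType K := sl_type.

Lemma sl_val_hom : is_lie_hom (sl_val : sl_alg -> g).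
Proof. by split=> [a x y|x y //]; rewrite sl_valD. Qed.

End SubLieAlg.

Definition sl_incl (g : lieAlgType K) (A B : subLie g) (AB : A `<=` B)
  (x : sl_type A) : sl_type B := sl_mk (AB _ (sl_mem x)).

Lemma sl_incl_linear (g : lieAlgType K) (A B : subLie g) (AB : A `<=` B) :
  linear (sl_incl AB).
Proof. by move=> a x y; apply: sl_val_inj; rewrite sl_valD; exact: sl_valD. Qed.

HB.instance Definition _ (g : lieAlgType K) (A B : subLie g) (AB : A `<=` B) :=
  GRing.isLinear.Build K (sl_type A) (sl_type B) _ (sl_incl AB)
    (sl_incl_linear AB).

Record lieModule (g : lieAlgType K) := LieModule {
  lm_sort :> lmodType K;
  act : g -> lm_sort -> lm_sort;
  act_linearl : forall a x y v, act (a *: x + y) v = a *: act x v + act y v;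
  act_linearr : forall a x v w, act x (a *: v + w) = a *: act x v + act x w;
  act_lie : forall x y v, act (lie x y) v = act x (act y v) - act y (act x v)
}.

Section Modules.
Variable g : lieAlgType K.

Definition is_hom (M N : lieModule g) (f : M -> N) : Prop :=
  (forall a v w, f (a *: v + w) = a *: f v + f w) /\
  (forall x v, f (act x v) = act x (f v)).

Definition isomorphic (M N : lieModule g) : Prop :=
  exists2 f : M -> N, is_hom f & bijective f.

Record submodule (M : lieModule g) := Submodule {
  sm_set :> set M;
  sm_subspace : is_subspace sm_set;
  sm_act : forall x v, sm_set v -> sm_set (act x v)
}.

Definition irreducible (M : lieModule g) : Prop :=
  (exists v : M, v <> 0) /\
  (forall N : submodule M, (N : set M) = [set 0] \/ (N : set M) = setT).

Lemma act0 (M : lieModule g) x : act x (0 : M) = 0.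
Proof. by have := act_linearr (-1) x (0 : M) 0; rewrite scaler0 add0r scaleN1r addNr. Qed.

Definition pullback (h : lieAlgType K) (f : h -> g) (fP : is_lie_hom f)
  (M : lieModule g) : lieModule h.
Proof.
refine (@LieModule h M (fun x v => act (f x) v) _ _ _).
- by move=> a x y v; rewrite fP.1 act_linearl.
- by move=> a x v w; rewrite act_linearr.
- by move=> x y v; rewrite fP.2 act_lie.
Defined.

End Modules.

Section QuotientModule.
Variables (g : lieAlgType K) (M : lieModule g) (N : submodule M).

Lemma smD v w : sm_set N v -> sm_set N w -> sm_set N (v + w).
Proof. by move=> Nv Nw; rewrite -[v]scale1r; apply: (sm_subspace N).2. Qed.

Lemma smZ a v : sm_set N v -> sm_set N (a *: v).
Proof.
move=> Nv; rewrite -[_ *: _]addr0.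
by apply: (sm_subspace N).2 => //; exact: (sm_subspace N).1.
Qed.

Definition qeqv : rel M := fun v w => `[< sm_set N (v - w) >].

Lemma qeqv_refl : reflexive qeqv.
Proof. by move=> v; apply/asboolP; rewrite subrr; exact: (sm_subspace N).1. Qed.

Lemma qeqv_sym : symmetric qeqv.
Proof.
have NN v w : sm_set N (v - w) -> sm_set N (w - v).
  by move=> Nvw; have := smZ (-1) Nvw; rewrite scaleN1r opprB.
by move=> v w; apply/asboolP/asboolP; exact: NN.
Qed.

Lemma qeqv_trans : transitive qeqv.
Proof.
move=> v u w /asboolP Nuv /asboolP Nvw; apply/asboolP.
by rewrite -(subrK v u) -addrA; exact: smD.
Qed.

Canonical qeqv_equiv := EquivRel qeqv qeqv_refl qeqv_sym qeqv_trans.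

Definition quot := {eq_quot qeqv}.
HB.instance Definition _ := Choice.on quot.
HB.instance Definition _ := EqQuotient.on quot.

Definition qpi (v : M) : quot := \pi_quot v.

Lemma qpiP v w : qpi v = qpi w <-> sm_set N (v - w).
Proof. by split=> [/eqmodP/asboolP|Nvw]//; apply/eqmodP/asboolP. Qed.

Lemma qpi_surj (u : quot) : exists v, u = qpi v.
Proof. by exists (repr u); rewrite /qpi reprK. Qed.

Lemma reprQ v : sm_set N (repr (qpi v) - v).
Proof. by apply/qpiP; rewrite /qpi reprK. Qed.

Definition qadd (u v : quot) : quot := qpi (repr u + repr v).
Definition qopp (u : quot) : quot := qpi (- repr u).
Definition qscale (a : K) (u : quot) : quot := qpi (a *: repr u).
Definition qact (x : g) (u : quot) : quot := qpi (act x (repr u)).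

Lemma qaddE v w : qadd (qpi v) (qpi w) = qpi (v + w).
Proof. by apply/qpiP; rewrite opprD addrACA; apply: smD; exact: reprQ. Qed.

Lemma qoppE v : qopp (qpi v) = qpi (- v).
Proof. by apply/qpiP; rewrite -opprD; have := smZ (-1) (reprQ v); rewrite scaleN1r. Qed.

Lemma qscaleE a v : qscale a (qpi v) = qpi (a *: v).
Proof. by apply/qpiP; rewrite -scalerBr; apply: smZ; exact: reprQ. Qed.

Lemma actB (P : lieModule g) x (v w : P) : act x (v - w) = act x v - act x w.
Proof. by rewrite addrC -scaleN1r act_linearr scaleN1r addrC. Qed.

Lemma qactE x v : qact x (qpi v) = qpi (act x v).
Proof. by apply/qpiP; rewrite -actB; apply: sm_act; exact: reprQ. Qed.

Fact qaddA : associative qadd.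
Proof.
move=> u v w; have [u' ->] := qpi_surj u; have [v' ->] := qpi_surj v.
by have [w' ->] := qpi_surj w; rewrite !qaddE addrA.
Qed.

Fact qaddC : commutative qadd.
Proof.
move=> u v; have [u' ->] := qpi_surj u; have [v' ->] := qpi_surj v.
by rewrite !qaddE addrC.
Qed.

Fact qadd0 : left_id (qpi 0) qadd.
Proof. by move=> u; have [u' ->] := qpi_surj u; rewrite qaddE add0r. Qed.

Fact qaddN : left_inverse (qpi 0) qopp qadd.
Proof. by move=> u; have [u' ->] := qpi_surj u; rewrite qoppE qaddE addNr. Qed.

HB.instance Definition _ := GRing.isZmodule.Build quot qaddA qaddC qadd0 qaddN.

Fact qscaleA a b u : qscale a (qscale b u) = qscale (a * b) u.
Proof. by have [u' ->] := qpi_surj u; rewrite !qscaleE scalerA. Qed.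

Fact qscale1 : left_id 1 qscale.
Proof. by move=> u; have [u' ->] := qpi_surj u; rewrite qscaleE scale1r. Qed.

Fact qscaleDr : right_distributive qscale +%R.
Proof.
move=> a u v; have [u' ->] := qpi_surj u; have [v' ->] := qpi_surj v.
by rewrite /GRing.add /= !(qscaleE, qaddE) scalerDr.
Qed.

Fact qscaleDl u : {morph qscale^~ u : a b / a + b}.
Proof.
by move=> a b; have [u' ->] := qpi_surj u; rewrite !qscaleE [RHS]qaddE scalerDl.
Qed.

HB.instance Definition _ :=
  GRing.Zmodule_isLmodule.Build K quot qscaleA qscale1 qscaleDr qscaleDl.

Lemma qpi_linear a v w : qpi (a *: v + w) = a *: qpi v + qpi w.
Proof. by rewrite /GRing.scale /GRing.add /= qscaleE qaddE. Qed.

Definition quot_module : lieModule g.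
Proof.
refine (@LieModule g quot qact _ _ _).
- move=> a x y u; have [v ->] := qpi_surj u.
  by rewrite !qactE act_linearl qpi_linear.
- move=> a x u w; have [u' ->] := qpi_surj u; have [w' ->] := qpi_surj w.
  by rewrite -qpi_linear !qactE act_linearr qpi_linear.
- move=> x y u; have [v ->] := qpi_surj u.
  rewrite !qactE act_lie addrC [in RHS]addrC -!scaleN1r.
  by rewrite qpi_linear.
Defined.

Lemma qpi_hom : is_hom (qpi : M -> quot_module).
Proof. by split=> [a v w|x v]; rewrite ?qpi_linear // -qactE. Qed.

End QuotientModule.

Section IrreducibleQuotient.
Variables (g : lieAlgType K) (M : lieModule g).

Definition zero_submodule : submodule M.
Proof.
refine (@Submodule g M [set 0] _ _).
- by split=> // a x y -> -> /=; rewrite scaler0 addr0.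
- by move=> x v -> /=; rewrite act0.
Defined.

(* The irreducible quotient of M, meant for modules having exactly one.  If M
   has no irreducible quotient at all, this is M / 0 by convention. *)
Definition irr_quotient : lieModule g :=
  match pselect (exists N : submodule M, irreducible (quot_module N)) with
  | left h => quot_module (projT1 (cid h))
  | right _ => quot_module zero_submodule
  end.

End IrreducibleQuotient.

(* U(g) is presented as the unital associative K-algebra generated by g subject
   to linearity of g -> U(g) and [x, y] = x y - y x: noncommutative polynomial
   expressions in elements of g, modulo the least congruence containing the
   axioms of associative K-algebras and these relations. *)

Inductive uterm (g : Type) : Type :=
| UGen of g
| UScal of K
| UAdd of uterm g & uterm g
| UMul of uterm g & uterm g.
Arguments UScal {g}.

Section Enveloping.
Variable g : lieAlgType K.
Local Notation T := (uterm g).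
Local Notation UOpp t := (UMul (UScal (-1)) t).

Inductive ueqv : T -> T -> Prop :=
| ue_refl t : ueqv t t
| ue_sym s t : ueqv s t -> ueqv t s
| ue_trans s t u : ueqv s t -> ueqv t u -> ueqv s u
| ue_add s s' t t' : ueqv s s' -> ueqv t t' -> ueqv (UAdd s t) (UAdd s' t')
| ue_mul s s' t t' : ueqv s s' -> ueqv t t' -> ueqv (UMul s t) (UMul s' t')
| ue_addA s t u : ueqv (UAdd s (UAdd t u)) (UAdd (UAdd s t) u)
| ue_addC s t : ueqv (UAdd s t) (UAdd t s)
| ue_add0 t : ueqv (UAdd (UScal 0) t) t
| ue_addN t : ueqv (UAdd (UOpp t) t) (UScal 0)
| ue_mulA s t u : ueqv (UMul s (UMul t u)) (UMul (UMul s t) u)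
| ue_mul1 t : ueqv (UMul (UScal 1) t) t
| ue_mulDl s t u : ueqv (UMul (UAdd s t) u) (UAdd (UMul s u) (UMul t u))
| ue_mulDr s t u : ueqv (UMul s (UAdd t u)) (UAdd (UMul s t) (UMul s u))
| ue_scalD a b : ueqv (UScal (a + b)) (UAdd (UScal a) (UScal b))
| ue_scalM a b : ueqv (UScal (a * b)) (UMul (UScal a) (UScal b))
| ue_scalC a t : ueqv (UMul (UScal a) t) (UMul t (UScal a))
| ue_genD a x y :
    ueqv (UGen (a *: x + y)) (UAdd (UMul (UScal a) (UGen x)) (UGen y))
| ue_genL x y : ueqv (UGen (lie x y))
    (UAdd (UMul (UGen x) (UGen y)) (UOpp (UMul (UGen y) (UGen x)))).

HB.instance Definition _ := gen_eqMixin T.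
HB.instance Definition _ := gen_choiceMixin T.

Definition ueqvb : rel T := fun s t => `[< ueqv s t >].

Lemma ueqvb_refl : reflexive ueqvb.
Proof. by move=> t; apply/asboolP; exact: ue_refl. Qed.
Lemma ueqvb_sym : symmetric ueqvb.
Proof. by move=> s t; apply/asboolP/asboolP; exact: ue_sym. Qed.
Lemma ueqvb_trans : transitive ueqvb.
Proof.
by move=> t s u /asboolP st /asboolP tu; apply/asboolP; exact: ue_trans tu.
Qed.

Canonical ueqvb_equiv := EquivRel ueqvb ueqvb_refl ueqvb_sym ueqvb_trans.

Definition envel := {eq_quot ueqvb}.
HB.instance Definition _ := Choice.on envel.
HB.instance Definition _ := EqQuotient.on envel.

Definition upi (t : T) : envel := \pi_envel t.

Lemma upiP s t : upi s = upi t <-> ueqv s t.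
Proof. by split=> [/eqmodP/asboolP|st]//; apply/eqmodP/asboolP. Qed.

Lemma upi_surj (u : envel) : exists t, u = upi t.
Proof. by exists (repr u); rewrite /upi reprK. Qed.

Lemma reprU t : ueqv (repr (upi t)) t.
Proof. by apply/upiP; rewrite /upi reprK. Qed.

Definition uadd (u v : envel) : envel := upi (UAdd (repr u) (repr v)).
Definition umul (u v : envel) : envel := upi (UMul (repr u) (repr v)).
Definition uscal (a : K) : envel := upi (UScal a).
Definition uopp (u : envel) : envel := umul (uscal (-1)) u.

Lemma uaddE s t : uadd (upi s) (upi t) = upi (UAdd s t).
Proof. by apply/upiP; apply: ue_add; exact: reprU. Qed.
Lemma umulE s t : umul (upi s) (upi t) = upi (UMul s t).
Proof. by apply/upiP; apply: ue_mul; exact: reprU. Qed.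

Local Ltac ulift u := let t := fresh "t" in have [t ->] := upi_surj u.

Fact uaddA : associative uadd.
Proof. by move=> u v w; ulift u; ulift v; ulift w; rewrite !uaddE; apply/upiP/ue_addA. Qed.
Fact uaddC : commutative uadd.
Proof. by move=> u v; ulift u; ulift v; rewrite !uaddE; apply/upiP/ue_addC. Qed.
Fact uadd0 : left_id (uscal 0) uadd.
Proof. by move=> u; ulift u; rewrite uaddE; apply/upiP/ue_add0. Qed.
Fact uaddN : left_inverse (uscal 0) uopp uadd.
Proof. by move=> u; ulift u; rewrite /uopp umulE uaddE; apply/upiP/ue_addN. Qed.

HB.instance Definition _ := GRing.isZmodule.Build envel uaddA uaddC uadd0 uaddN.

Fact umulA : associative umul.
Proof. by move=> u v w; ulift u; ulift v; ulift w; rewrite !umulE; apply/upiP/ue_mulA. Qed.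
Fact umul1 : left_id (uscal 1) umul.
Proof. by move=> u; ulift u; rewrite umulE; apply/upiP/ue_mul1. Qed.
Fact uscalC a u : umul (uscal a) u = umul u (uscal a).
Proof. by ulift u; rewrite !umulE; apply/upiP/ue_scalC. Qed.
Fact umulr1 : right_id (uscal 1) umul.
Proof. by move=> u; rewrite -uscalC umul1. Qed.
Fact umulDl : left_distributive umul +%R.
Proof.
move=> u v w; ulift u; ulift v; ulift w.
by rewrite /GRing.add /= !(uaddE, umulE); apply/upiP/ue_mulDl.
Qed.
Fact umulDr : right_distributive umul +%R.
Proof.
move=> u v w; ulift u; ulift v; ulift w.
by rewrite /GRing.add /= !(uaddE, umulE); apply/upiP/ue_mulDr.
Qed.

(* The augmentation g -> 0, showing that U(g) is a nontrivial ring. *)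
Fixpoint uaug (t : T) : K :=
  match t with
  | UGen _ => 0
  | UScal a => a
  | UAdd s t => uaug s + uaug t
  | UMul s t => uaug s * uaug t
  end.

Lemma uaug_eqv s t : ueqv s t -> uaug s = uaug t.
Proof.
elim=> //= {s t}; try by move=> *; congruence.
- by move=> s t u; rewrite addrA.
- by move=> s t; rewrite addrC.
- by move=> t; rewrite add0r.
- by move=> t; rewrite mulN1r addNr.
- by move=> s t u; rewrite mulrA.
- by move=> t; rewrite mul1r.
- by move=> s t u; rewrite mulrDl.
- by move=> s t u; rewrite mulrDr.
- by move=> a t; rewrite mulrC.
- by move=> a _ _; rewrite mulr0 addr0.
- by move=> _ _; rewrite !mulr0 addr0.
Qed.

Fact uone_neq0 : uscal 1 != 0 :> envel.
Proof. by apply/eqP => /upiP/uaug_eqv /= /eqP; rewrite oner_eq0. Qed.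

HB.instance Definition _ := GRing.Zmodule_isNzRing.Build envel
  umulA umul1 umulr1 umulDl umulDr uone_neq0.

Definition uscale (a : K) (u : envel) : envel := umul (uscal a) u.

Fact uscaleA a b u : uscale a (uscale b u) = uscale (a * b) u.
Proof. by rewrite /uscale umulA umulE; congr umul; apply/esym/upiP/ue_scalM. Qed.
Fact uscaleDl u : {morph uscale^~ u : a b / a + b}.
Proof.
move=> a b; rewrite -[RHS]umulDl; congr umul.
by rewrite [RHS]uaddE; apply/upiP/ue_scalD.
Qed.
Fact uscaleDr : right_distributive uscale +%R.
Proof. by move=> a u v; exact: umulDr. Qed.

HB.instance Definition _ :=
  GRing.Zmodule_isLmodule.Build K envel uscaleA umul1 uscaleDr uscaleDl.

Fact uscaleAl (a : K) (u v : envel) : a *: (u * v) = (a *: u) * v.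
Proof. exact: umulA. Qed.
HB.instance Definition _ := GRing.Lmodule_isLalgebra.Build K envel uscaleAl.

Fact uscaleAr (a : K) (u v : envel) : a *: (u * v) = u * (a *: v).
Proof.
rewrite /GRing.scale /GRing.mul /= /uscale !umulA.
by congr umul; exact: uscalC.
Qed.
HB.instance Definition _ := GRing.Lalgebra_isAlgebra.Build K envel uscaleAr.

Definition ugen (x : g) : envel := upi (UGen x).

Lemma ugenD a x y : ugen (a *: x + y) = a *: ugen x + ugen y.
Proof.
have -> : a *: ugen x = upi (UMul (UScal a) (UGen x)) by exact: umulE.
by rewrite [RHS]uaddE; apply/upiP; exact: ue_genD.
Qed.

Lemma ugen_lie x y : ugen (lie x y) = ugen x * ugen y - ugen y * ugen x.
Proof.
have gE z t : ugen z * ugen t = upi (UMul (UGen z) (UGen t)) by exact: umulE.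
have -> : - (ugen y * ugen x) = upi (UOpp (UMul (UGen y) (UGen x))).
  by rewrite gE; exact: umulE.
by rewrite gE [RHS]uaddE; apply/upiP; exact: ue_genL.
Qed.

End Enveloping.

Section EnvelopingAction.
Variables (g : lieAlgType K) (M : lieModule g).

Fixpoint tact (t : uterm g) (v : M) : M :=
  match t with
  | UGen x => act x v
  | UScal a => a *: v
  | UAdd s t => tact s v + tact t v
  | UMul s t => tact s (tact t v)
  end.

Lemma tact_linear t a v w : tact t (a *: v + w) = a *: tact t v + tact t w.
Proof.
elim: t a v w => [x|b|s IHs t IHt|s IHs t IHt] a v w /=.
- exact: act_linearr.
- by rewrite scalerDr !scalerA mulrC.
- by rewrite IHs IHt scalerDr addrACA.
- by rewrite IHt IHs.
Qed.

Lemma tact_eqv s t : ueqv s t -> forall v, tact s v = tact t v.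
Proof.
elim=> //= {s t}.
- by move=> s t u _ IH1 _ IH2 v; rewrite IH1.
- by move=> s s' t t' _ IH1 _ IH2 v; rewrite IH1 IH2.
- by move=> s s' t t' _ IH1 _ IH2 v; rewrite IH2 IH1.
- by move=> *; rewrite addrA.
- by move=> *; rewrite addrC.
- by move=> *; rewrite scale0r add0r.
- by move=> *; rewrite scale0r scaleN1r addNr.
- by move=> *; rewrite scale1r.
- by move=> s t u v; rewrite -[tact t v]scale1r tact_linear !scale1r.
- by move=> *; rewrite scalerDl.
- by move=> *; rewrite scalerA.
- move=> a t v; rewrite -[a *: v]addr0 tact_linear -[LHS]addr0; congr +%R.
  by have := tact_linear t (-1) 0 0; rewrite scaler0 addr0 scaleN1r addNr.
- by move=> *; rewrite act_linearl.
- by move=> *; rewrite act_lie scaleN1r.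
Qed.

Definition uact (u : envel g) (v : M) : M := tact (repr u) v.

Lemma uactE t v : uact (upi t) v = tact t v.
Proof. exact/tact_eqv/reprU. Qed.

End EnvelopingAction.

Section EnvelopingInclusion.
Variables (g : lieAlgType K) (p : subLie g).

Fixpoint tincl (t : uterm (sl_alg p)) : uterm g :=
  match t with
  | UGen x => UGen (sl_val x)
  | UScal a => UScal a
  | UAdd s t => UAdd (tincl s) (tincl t)
  | UMul s t => UMul (tincl s) (tincl t)
  end.

Lemma tincl_eqv s t : ueqv s t -> ueqv (tincl s) (tincl t).
Proof.
by elim=> /= *; rewrite ?sl_valD; solve [econstructor; eassumption].
Qed.

Definition uincl (u : envel (sl_alg p)) : envel g := upi (tincl (repr u)).

Lemma uinclE t : uincl (upi t) = upi (tincl t).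
Proof. exact/upiP/tincl_eqv/reprU. Qed.

End EnvelopingInclusion.

(* U(g) (x)_{U(p)} V as the abelian group generated by the symbols u (x) v,
   subject to biadditivity and (u b) (x) v = u (x) (b v) for all b in U(p). *)

Inductive tterm (A V : Type) : Type :=
| TTens of A & V
| TZero
| TAdd of tterm A V & tterm A V
| TOpp of tterm A V.
Arguments TZero {A V}.

Section Induced.
Variables (g : lieAlgType K) (p : subLie g) (V : lieModule (sl_alg p)).
Local Notation T := (tterm (envel g) V).

Inductive teqv : T -> T -> Prop :=
| te_refl t : teqv t t
| te_sym s t : teqv s t -> teqv t s
| te_trans s t u : teqv s t -> teqv t u -> teqv s u
| te_add s s' t t' : teqv s s' -> teqv t t' -> teqv (TAdd s t) (TAdd s' t')
| te_opp s s' : teqv s s' -> teqv (TOpp s) (TOpp s')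
| te_addA s t u : teqv (TAdd s (TAdd t u)) (TAdd (TAdd s t) u)
| te_addC s t : teqv (TAdd s t) (TAdd t s)
| te_add0 t : teqv (TAdd TZero t) t
| te_addN t : teqv (TAdd (TOpp t) t) TZero
| te_tensDl u u' v :
    teqv (TTens (u + u') v) (TAdd (TTens u v) (TTens u' v))
| te_tensDr u v v' :
    teqv (TTens u (v + v')) (TAdd (TTens u v) (TTens u v'))
| te_tensB u (b : envel (sl_alg p)) v :
    teqv (TTens (u * uincl b) v) (TTens u (uact b v)).

HB.instance Definition _ := gen_eqMixin T.
HB.instance Definition _ := gen_choiceMixin T.

Definition teqvb : rel T := fun s t => `[< teqv s t >].

Lemma teqvb_refl : reflexive teqvb.
Proof. by move=> t; apply/asboolP; exact: te_refl. Qed.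
Lemma teqvb_sym : symmetric teqvb.
Proof. by move=> s t; apply/asboolP/asboolP; exact: te_sym. Qed.
Lemma teqvb_trans : transitive teqvb.
Proof.
by move=> t s u /asboolP st /asboolP tu; apply/asboolP; exact: te_trans tu.
Qed.

Canonical teqvb_equiv := EquivRel teqvb teqvb_refl teqvb_sym teqvb_trans.

Definition induced := {eq_quot teqvb}.
HB.instance Definition _ := Choice.on induced.
HB.instance Definition _ := EqQuotient.on induced.

Definition tpi (t : T) : induced := \pi_induced t.

Lemma tpiP s t : tpi s = tpi t <-> teqv s t.
Proof. by split=> [/eqmodP/asboolP|st]//; apply/eqmodP/asboolP. Qed.

Lemma tpi_surj (u : induced) : exists t, u = tpi t.
Proof. by exists (repr u); rewrite /tpi reprK. Qed.

Lemma reprT t : teqv (repr (tpi t)) t.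
Proof. by apply/tpiP; rewrite /tpi reprK. Qed.

Definition tadd (m n : induced) : induced := tpi (TAdd (repr m) (repr n)).
Definition topp (m : induced) : induced := tpi (TOpp (repr m)).

Lemma taddE s t : tadd (tpi s) (tpi t) = tpi (TAdd s t).
Proof. by apply/tpiP; apply: te_add; exact: reprT. Qed.
Lemma toppE s : topp (tpi s) = tpi (TOpp s).
Proof. by apply/tpiP; apply: te_opp; exact: reprT. Qed.

Local Ltac tlift u := let t := fresh "t" in have [t ->] := tpi_surj u.

Fact taddA : associative tadd.
Proof. by move=> u v w; tlift u; tlift v; tlift w; rewrite !taddE; apply/tpiP/te_addA. Qed.
Fact taddC : commutative tadd.
Proof. by move=> u v; tlift u; tlift v; rewrite !taddE; apply/tpiP/te_addC. Qed.
Fact tadd0 : left_id (tpi TZero) tadd.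
Proof. by move=> u; tlift u; rewrite taddE; apply/tpiP/te_add0. Qed.
Fact taddN : left_inverse (tpi TZero) topp tadd.
Proof. by move=> u; tlift u; rewrite toppE taddE; apply/tpiP/te_addN. Qed.

HB.instance Definition _ := GRing.isZmodule.Build induced taddA taddC tadd0 taddN.

Definition tens (u : envel g) (v : V) : induced := tpi (TTens u v).

Lemma tpi_add s t : tpi (TAdd s t) = tpi s + tpi t.
Proof. exact/esym/taddE. Qed.
Lemma tpi_opp s : tpi (TOpp s) = - tpi s.
Proof. exact/esym/toppE. Qed.

Lemma tensDl u u' v : tens (u + u') v = tens u v + tens u' v.
Proof. by rewrite -tpi_add; apply/tpiP/te_tensDl. Qed.
Lemma tensDr u v v' : tens u (v + v') = tens u v + tens u v'.
Proof. by rewrite -tpi_add; apply/tpiP/te_tensDr. Qed.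
Lemma tensB u b v : tens (u * uincl b) v = tens u (uact b v).
Proof. exact/tpiP/te_tensB. Qed.

Lemma induced_ind (P : induced -> Prop) :
  (forall u v, P (tens u v)) -> P 0 ->
  (forall m n, P m -> P n -> P (m + n)) -> (forall m, P m -> P (- m)) ->
  forall m, P m.
Proof.
move=> Pt P0 PD PN m; tlift m; elim: t => [u v||s Ps t Pt'|s Ps].
- exact: Pt.
- exact: P0.
- by rewrite tpi_add; apply: PD.
- by rewrite tpi_opp; apply: PN.
Qed.

Fixpoint tlmul (a : envel g) (t : T) : T :=
  match t with
  | TTens u v => TTens (a * u) v
  | TZero => TZero
  | TAdd s t => TAdd (tlmul a s) (tlmul a t)
  | TOpp s => TOpp (tlmul a s)
  end.

Lemma tlmul_eqv a s t : teqv s t -> teqv (tlmul a s) (tlmul a t).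
Proof.
elim=> /= *; rewrite ?mulrDr ?mulrA; try solve [econstructor; eassumption].
Qed.

Definition lmul (a : envel g) (m : induced) : induced := tpi (tlmul a (repr m)).

Lemma lmulE a t : lmul a (tpi t) = tpi (tlmul a t).
Proof. exact/tpiP/tlmul_eqv/reprT. Qed.

Lemma lmul_tens a u v : lmul a (tens u v) = tens (a * u) v.
Proof. exact: lmulE. Qed.
Lemma lmulr0 a : lmul a 0 = 0.
Proof. exact: lmulE. Qed.
Lemma lmulrD a m n : lmul a (m + n) = lmul a m + lmul a n.
Proof. by tlift m; tlift n; rewrite -tpi_add !lmulE -tpi_add. Qed.
Lemma lmulrN a m : lmul a (- m) = - lmul a m.
Proof. by tlift m; rewrite -tpi_opp !lmulE -tpi_opp. Qed.

Lemma lmulDl a b m : lmul (a + b) m = lmul a m + lmul b m.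
Proof.
elim/induced_ind: m => [u v||m n IHm IHn|m IH].
- by rewrite !lmul_tens mulrDl tensDl.
- by rewrite !lmulr0 addr0.
- by rewrite !lmulrD IHm IHn addrACA.
- by rewrite !lmulrN IH opprD.
Qed.

Lemma lmulA a b m : lmul a (lmul b m) = lmul (a * b) m.
Proof.
elim/induced_ind: m => [u v||m n IHm IHn|m IH].
- by rewrite !lmul_tens mulrA.
- by rewrite !lmulr0.
- by rewrite !lmulrD IHm IHn.
- by rewrite !lmulrN IH.
Qed.

Lemma lmul1 m : lmul 1 m = m.
Proof.
elim/induced_ind: m => [u v||m n IHm IHn|m IH].
- by rewrite !lmul_tens mul1r.
- by rewrite !lmulr0.
- by rewrite !lmulrD IHm IHn.
- by rewrite !lmulrN IH.
Qed.

Lemma lmulNl a m : lmul (- a) m = - lmul a m.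
Proof.
apply/eqP; rewrite -addr_eq0 -lmulDl addNr; apply/eqP.
by have := lmulDl 0 0 m; rewrite addr0 -{1}[lmul 0 m]addr0 => /addrI.
Qed.

Definition ind_scale (a : K) (m : induced) : induced := lmul a%:A m.

Fact ind_scaleA a b m : ind_scale a (ind_scale b m) = ind_scale (a * b) m.
Proof. by rewrite /ind_scale lmulA -scalerAl mul1r scalerA. Qed.
Fact ind_scale1 : left_id 1 ind_scale.
Proof. by move=> m; rewrite /ind_scale scale1r lmul1. Qed.
Fact ind_scaleDr : right_distributive ind_scale +%R.
Proof. by move=> a m n; exact: lmulrD. Qed.
Fact ind_scaleDl m : {morph ind_scale^~ m : a b / a + b}.
Proof. by move=> a b; rewrite /ind_scale scalerDl lmulDl. Qed.

HB.instance Definition _ := GRing.Zmodule_isLmodule.Build K induced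
  ind_scaleA ind_scale1 ind_scaleDr ind_scaleDl.

Definition induced_module : lieModule g.
Proof.
refine (@LieModule g induced (fun x m => lmul (ugen x) m) _ _ _).
- move=> a x y m; rewrite ugenD lmulDl; congr +%R.
  by rewrite /GRing.scale /= /ind_scale lmulA -scalerAl mul1r.
- move=> a x m n; rewrite lmulrD; congr +%R.
  by rewrite /GRing.scale /= /ind_scale !lmulA -scalerAl -scalerAr mul1r mulr1.
- by move=> x y m; rewrite ugen_lie lmulDl lmulNl !lmulA.
Defined.

End Induced.

End LieTheory.

Section GlInf.
Variable R : realType.
Local Notation C := R[i].

Record glinf := GlInf {
  glmx :> int -> int -> C;
  glmx_fin : finite_set [set p : int * int | glmx p.1 p.2 != 0]
}.

HB.instance Definition _ := gen_eqMixin glinf.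
HB.instance Definition _ := gen_choiceMixin glinf.

Lemma gl_ext (x y : glinf) : (forall i j, x i j = y i j) -> x = y.
Proof.
case: x y => [x xf] [y yf] /= xy.
have {}xy : x = y by apply/funext => i; apply/funext => j.
by move: xf; rewrite xy => xf; congr GlInf; exact: Prop_irrelevance.
Qed.

Lemma gl_bound (x : glinf) : exists2 s : seq int, uniq s &
  forall i j, x i j != 0 -> (i \in s) && (j \in s).
Proof.
have [t tE] := (finite_seqP _).1 (glmx_fin x).
exists (undup ([seq p.1 | p <- t] ++ [seq p.2 | p <- t])).
  exact: undup_uniq.
move=> i j xij; have {}xij : (i, j) \in t.
  by have : [set` t] (i, j) by rewrite -tE.
rewrite !mem_undup !mem_cat; apply/andP; split; apply/orP.
  by left; apply/mapP; exists (i, j).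
by right; apply/mapP; exists (i, j).
Qed.

Lemma gl_fin_sub (f : int -> int -> C) (s : seq int) :
  (forall i j, f i j != 0 -> (i \in s) && (j \in s)) ->
  finite_set [set p : int * int | f p.1 p.2 != 0].
Proof.
move=> fs; apply: (sub_finite_set (B := [set` [seq (i, j) | i <- s, j <- s]])).
  move=> [i j] /= /fs /andP[is_ js]; exact: allpairs_f.
exact: finite_seq.
Qed.

Fact gl_zero_fin : finite_set [set p : int * int | (0 : C) != 0].
Proof. by apply: (@gl_fin_sub (fun _ _ => 0) [::]) => i j; rewrite eqxx. Qed.

Fact gl_lin_fin (a : C) (x y : glinf) :
  finite_set [set p : int * int | a * x p.1 p.2 + y p.1 p.2 != 0].
Proof.
have [s _ xs] := gl_bound x; have [t _ yt] := gl_bound y.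
apply: (@gl_fin_sub (fun i j => a * x i j + y i j) (s ++ t)) => i j.
rewrite !mem_cat; have [->|/xs/andP[-> ->]//] := eqVneq (x i j) 0.
by rewrite mulr0 add0r => /yt/andP[-> ->]; rewrite !orbT.
Qed.

Definition gl_zero : glinf := @GlInf (fun _ _ => 0) gl_zero_fin.
Definition gl_lin (a : C) (x y : glinf) : glinf :=
  @GlInf (fun i j => a * x i j + y i j) (gl_lin_fin a x y).
Definition gl_add (x y : glinf) : glinf := gl_lin 1 x y.
Definition gl_opp (x : glinf) : glinf := gl_lin (-1) x gl_zero.
Definition gl_scale (a : C) (x : glinf) : glinf := gl_lin a x gl_zero.

Fact gl_addA : associative gl_add.
Proof. by move=> x y z; apply: gl_ext => i j /=; rewrite !mul1r addrA. Qed.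
Fact gl_addC : commutative gl_add.
Proof. by move=> x y; apply: gl_ext => i j /=; rewrite !mul1r addrC. Qed.
Fact gl_add0 : left_id gl_zero gl_add.
Proof. by move=> x; apply: gl_ext => i j /=; rewrite mulr0 add0r. Qed.
Fact gl_addN : left_inverse gl_zero gl_opp gl_add.
Proof.
by move=> x; apply: gl_ext => i j /=; rewrite mul1r addr0 mulN1r addNr.
Qed.

HB.instance Definition _ := GRing.isZmodule.Build glinf gl_addA gl_addC gl_add0 gl_addN.

Fact gl_scaleA a b x : gl_scale a (gl_scale b x) = gl_scale (a * b) x.
Proof. by apply: gl_ext => i j /=; rewrite !addr0 mulrA. Qed.
Fact gl_scale1 : left_id 1 gl_scale.
Proof. by move=> x; apply: gl_ext => i j /=; rewrite addr0 mul1r. Qed.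
Fact gl_scaleDr : right_distributive gl_scale +%R.
Proof. by move=> a x y; apply: gl_ext => i j /=; ring. Qed.
Fact gl_scaleDl x : {morph gl_scale^~ x : a b / a + b}.
Proof. by move=> a b; apply: gl_ext => i j /=; ring. Qed.

HB.instance Definition _ := GRing.Zmodule_isLmodule.Build C glinf
  gl_scaleA gl_scale1 gl_scaleDr gl_scaleDl.

Lemma gl0E i j : (0 : glinf) i j = 0. Proof. by []. Qed.
Lemma glDE (x y : glinf) i j : (x + y) i j = x i j + y i j.
Proof. by rewrite /= mul1r. Qed.
Lemma glNE (x : glinf) i j : (- x) i j = - x i j.
Proof. by rewrite /= addr0 mulN1r. Qed.
Lemma glZE a (x : glinf) i j : (a *: x) i j = a * x i j.
Proof. by rewrite /= addr0. Qed.
Lemma gl_sumE I (s : seq I) (F : I -> glinf) i j :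
  (\sum_(k <- s) F k) i j = \sum_(k <- s) F k i j.
Proof.
by elim: s => [|k s IH]; rewrite ?big_nil // !big_cons glDE IH.
Qed.

Definition glmul_mx (x y : glinf) (i j : int) : C :=
  \sum_(k \in [set: int]) x i k * y k j.

Lemma glmul_mxE (x y : glinf) (s : seq int) i j : uniq s ->
  (forall k, x i k * y k j != 0 -> k \in s) ->
  glmul_mx x y i j = \sum_(k <- s) x i k * y k j.
Proof.
move=> us xs; rewrite /glmul_mx (fsbigE s) //.
  by apply: eq_bigl => k; rewrite in_setT.
by move=> k _; apply: contraNeq; exact: xs.
Qed.

Lemma gl_bound3 (x y z : glinf) : exists2 s : seq int, uniq s &
  forall i j, [|| x i j != 0, y i j != 0 | z i j != 0] ->
    (i \in s) && (j \in s).
Proof.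
have [s _ xs] := gl_bound x; have [t _ yt] := gl_bound y.
have [u _ zu] := gl_bound z; exists (undup (s ++ t ++ u)).
  exact: undup_uniq.
move=> i j /or3P[/xs|/yt|/zu] /andP[]; rewrite !mem_undup !mem_cat.
- by move=> -> ->.
- by move=> -> ->; rewrite !orbT.
- by move=> -> ->; rewrite !orbT.
Qed.

Lemma glmul_mx_neq0 (x y : glinf) i j : glmul_mx x y i j != 0 ->
  exists k, x i k != 0 /\ y k j != 0.
Proof.
apply: contraPP => /forallNP xy; apply/negP; rewrite negbK; apply/eqP.
apply: fsbig1 => k _; have [->|xk] := eqVneq (x i k) 0; first by rewrite mul0r.
have [->|yk] := eqVneq (y k j) 0; first by rewrite mulr0.
by case: (xy k).
Qed.

Fact glmul_fin (x y : glinf) :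
  finite_set [set p : int * int | glmul_mx x y p.1 p.2 != 0].
Proof.
have [s us xys] := gl_bound3 x y 0; apply: (@gl_fin_sub _ s) => i j.
move=> /glmul_mx_neq0[k [xk yk]]; apply/andP; split.
  by have /andP[] : (i \in s) && (k \in s) by apply: xys; rewrite xk.
by have /andP[] : (k \in s) && (j \in s) by apply: xys; rewrite yk orbT.
Qed.

Definition glmul (x y : glinf) : glinf := GlInf (glmul_fin x y).

Lemma glmulE (x y : glinf) (s : seq int) i j : uniq s ->
  (forall k l, y k l != 0 -> k \in s) ->
  glmul x y i j = \sum_(k <- s) x i k * y k j.
Proof.
move=> us ys; apply: glmul_mxE => // k; rewrite mulf_eq0 negb_or.
by move=> /andP[_]; exact: ys.
Qed.

Lemma glmulDl a (x y z : glinf) :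
  glmul (a *: x + y) z = a *: glmul x z + glmul y z.
Proof.
have [s us zs] := gl_bound z.
have {}zs k l : z k l != 0 -> k \in s by move=> /zs/andP[].
apply: gl_ext => i j; rewrite glDE glZE !(glmulE _ _ _ us) // big_distrr /=.
by rewrite -big_split /=; apply: eq_bigr => k _; ring.
Qed.

Lemma glmulDr a (x y z : glinf) :
  glmul x (a *: y + z) = a *: glmul x y + glmul x z.
Proof.
have [s us yzs] := gl_bound3 y z (a *: y + z).
apply: gl_ext => i j; rewrite glDE glZE !(glmulE _ _ _ us).
- rewrite big_distrr -big_split /=.
  by apply: eq_bigr => k _; ring.
- by move=> k l zk; have /andP[] := yzs k l ltac:(by rewrite zk orbT).
- by move=> k l yk; have /andP[] := yzs k l ltac:(by rewrite yk).
- move=> k l yzk; suff /andP[] : (k \in s) && (l \in s) by [].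
  by apply: yzs; rewrite yzk !orbT.
Qed.

Lemma glmulA (x y z : glinf) : glmul x (glmul y z) = glmul (glmul x y) z.
Proof.
have [s us ss] := gl_bound3 y z (glmul y z).
have ys k l : y k l != 0 -> k \in s.
  by move=> nz; have /andP[] := ss k l ltac:(by rewrite nz).
have zs k l : z k l != 0 -> k \in s.
  by move=> nz; have /andP[] := ss k l ltac:(by rewrite nz orbT).
have yzs k l : glmul y z k l != 0 -> k \in s.
  by move=> nz; have /andP[] := ss k l ltac:(by rewrite nz !orbT).
apply: gl_ext => i j; rewrite (glmulE _ _ _ us yzs) (glmulE _ _ _ us zs).
under eq_bigr => k _ do rewrite (glmulE _ _ _ us zs) big_distrr /=.
under [RHS]eq_bigr => k _ do rewrite (glmulE _ _ _ us ys) big_distrl /=.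
rewrite exchange_big /=; apply: eq_bigr => k _; apply: eq_bigr => l _.
by rewrite mulrA.
Qed.

Definition gl_lie (x y : glinf) : glinf := glmul x y - glmul y x.

Fact gl_lie_linearl a x y z :
  gl_lie (a *: x + y) z = a *: gl_lie x z + gl_lie y z.
Proof. by rewrite /gl_lie glmulDl glmulDr opprD addrACA -scalerBr. Qed.
Fact gl_lie_linearr a x y z :
  gl_lie x (a *: y + z) = a *: gl_lie x y + gl_lie x z.
Proof. by rewrite /gl_lie glmulDl glmulDr opprD addrACA -scalerBr. Qed.
Fact gl_liexx x : gl_lie x x = 0. Proof. exact: subrr. Qed.

Lemma glmulBr x y z : glmul x (y - z) = glmul x y - glmul x z.
Proof. by rewrite addrC -scaleN1r glmulDr scaleN1r addrC. Qed.
Lemma glmulBl x y z : glmul (x - y) z = glmul x z - glmul y z.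
Proof. by rewrite addrC -scaleN1r glmulDl scaleN1r addrC. Qed.

Fact gl_jacobi x y z :
  gl_lie x (gl_lie y z) + gl_lie y (gl_lie z x) + gl_lie z (gl_lie x y) = 0.
Proof.
rewrite /gl_lie !(glmulBr, glmulBl) !glmulA.
by apply: gl_ext => i j; rewrite !(glDE, glNE) gl0E; ring.
Qed.

HB.instance Definition _ := Lmodule_isLie.Build C glinf
  gl_lie_linearl gl_lie_linearr gl_liexx gl_jacobi.

Lemma gl_lieE (x y : glinf) i j :
  lie x y i j = glmul x y i j - glmul y x i j.
Proof. by rewrite -glNE -glDE. Qed.

Fact Emat_fin (m n : int) : finite_set
  [set p : int * int | ((p.1 == m) && (p.2 == n))%:R != 0 :> C].
Proof.
apply: (@gl_fin_sub (fun i j => ((i == m) && (j == n))%:R) [:: m; n]) => i j.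
by rewrite pnatr_eq0 eqb0 negbK !inE => /andP[-> ->]; rewrite orbT.
Qed.

Definition Emat (m n : int) : glinf :=
  @GlInf (fun i j => ((i == m) && (j == n))%:R) (Emat_fin m n).

Lemma glmulEE m n r s : glmul (Emat m n) (Emat r s) = (n == r)%:R *: Emat m s.
Proof.
apply: gl_ext => i j; rewrite glZE (@glmulE _ _ [:: r]) //.
  by rewrite big_seq1 /= eqxx -!natrM !mulnb; congr (_%:R);
    case: (i == m); case: (j == s); case: eqVneq.
move=> k l /=; rewrite pnatr_eq0 eqb0 negbK inE.
by case/andP.
Qed.

Lemma lieEE m n r s : lie (Emat m n) (Emat r s) =
  (n == r)%:R *: Emat m s - (m == s)%:R *: Emat r n.
Proof. by rewrite [LHS]/lie /= /gl_lie !glmulEE (eq_sym s). Qed.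

Definition espan (P : int -> int -> Prop) : set glinf :=
  span [set x | exists m n, P m n /\ x = Emat m n].

Lemma espanP P x : espan P x <-> forall i j, x i j != 0 -> P i j.
Proof.
split=> [xP|xP N NN EN].
  apply: (xP [set x : glinf | forall i j, x i j != 0 -> P i j]).
    split=> [i j|a y z yP zP i j]; first by rewrite gl0E eqxx.
    rewrite glDE glZE; have [->|/yP//] := eqVneq (y i j) 0.
    by rewrite mulr0 add0r => /zP.
  move=> _ [m [n [mn ->]]] i j /=; rewrite pnatr_eq0 eqb0 negbK.
  by move=> /andP[/eqP-> /eqP->].
have [s us xs] := gl_bound x.
have -> : x = \sum_(p <- [seq (i, j) | i <- s, j <- s]) x p.1 p.2 *: Emat p.1 p.2.
  apply: gl_ext => i j; rewrite gl_sumE.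
  have [x0|xij] := eqVneq (x i j) 0.
    rewrite x0 big1 // => -[k l] _; rewrite glZE /=.
    by case: andP => [[/eqP <- /eqP <-]|_]; rewrite ?mulr0 // x0 mul0r.
  have /andP[is_ js] := xs _ _ xij.
  have ps : (i, j) \in [seq (i, j) | i <- s, j <- s] by exact: allpairs_f.
  rewrite (bigD1_seq (i, j)) //=; last first.
    by apply: allpairs_uniq => // -[? ?] [? ?].
  rewrite !eqxx /= addr0 mulr1 big1 ?addr0 // => -[k l] /= kl.
  case: andP => [[/eqP ik /eqP jl]|_]; rewrite ?addr0 ?mulr0 //.
  by move: kl; rewrite ik jl eqxx.
apply: is_subspace_sum => // -[i j] /=.
have [->|/xP ij] := eqVneq (x i j) 0; first by rewrite scale0r; exact: NN.1.
rewrite -[_ *: _]addr0; apply: NN.2; last exact: NN.1.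
by apply: EN; exists i, j.
Qed.

Lemma espan_lie (P : int -> int -> Prop) :
  (forall i k j, P i k -> P k j -> P i j) ->
  forall x y, espan P x -> espan P y -> espan P (lie x y).
Proof.
move=> Ptr x y /espanP xP /espanP yP; apply/espanP => i j.
rewrite glDE glNE; have [->|] := eqVneq (glmul x y i j) 0.
  rewrite add0r oppr_eq0 => /glmul_mx_neq0[k [yk xk]].
  by apply: (Ptr _ k); [exact: yP|exact: xP].
move=> /glmul_mx_neq0[k [xk yk]] _.
by apply: (Ptr _ k); [exact: xP|exact: yP].
Qed.

Definition espan_alg (P : int -> int -> Prop)
    (Ptr : forall i k j, P i k -> P k j -> P i j) : subLie glinf :=
  SubLie (span_subspace _) (espan_lie Ptr).

Definition Hfull : subLie glinf.
Proof. by refine (@espan_alg (fun m n => m = n) _) => i k j -> ->. Defined.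

Definition Ediag (m : int) : sl_type Hfull :=
  @sl_mk _ _ Hfull (Emat m m)
    (sub_span (ex_intro _ m (ex_intro _ m (conj erefl erefl)))).

Section FixS.
Variable S : set int.

Definition glS : subLie glinf.
Proof.
refine (@espan_alg (fun m n => S m /\ S n) _) => i k j.
by move=> [Si _] [_ Sj].
Defined.

Definition HS : subLie glinf.
Proof.
refine (@espan_alg (fun m n => m = n /\ S n) _) => i k j.
by move=> [-> _] [-> Sj].
Defined.

Definition glplus : subLie glinf.
Proof. by refine (@espan_alg (fun _ n => ~ S n) _) => i k j. Defined.

Definition parabolic_set : set glinf := sum_sub (sl_set glplus) (sl_set glS).

Definition block_mx (x : glinf) (i j : int) : C :=
  if `[< S i /\ S j >] then x i j else 0.

Fact block_fin x : finite_set [set p : int * int | block_mx x p.1 p.2 != 0].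
Proof.
have [s _ xs] := gl_bound x; apply: (@gl_fin_sub _ s) => i j.
by rewrite /block_mx; case: ifP => _; [exact: xs|rewrite eqxx].
Qed.

Definition block (x : glinf) : glinf := GlInf (block_fin x).

Lemma block_glS x : sl_set glS (block x).
Proof.
apply/espanP => i j /=; rewrite /block_mx; case: asboolP => // _.
by rewrite eqxx.
Qed.

Lemma parabolicP x :
  parabolic_set x <-> forall i j, x i j != 0 -> S j -> S i.
Proof.
split=> [[y [z [/espanP yP /espanP zP ->]]] i j|xP].
  rewrite glDE; have [->|/yP//] := eqVneq (y i j) 0.
  by rewrite add0r => /zP[].
exists (x - block x), (block x); split; last by rewrite subrK.
- apply/espanP => i j; rewrite glDE glNE /= /block_mx.
  case: asboolP => [_|nS]; first by rewrite subrr eqxx.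
  by rewrite subr0 => xij Sj; apply: nS; split => //; exact: xP Sj.
- exact: block_glS.
Qed.

Fact parabolic_subspace : is_subspace parabolic_set.
Proof.
split; first by apply/parabolicP => i j; rewrite gl0E eqxx.
move=> a x y /parabolicP xP /parabolicP yP; apply/parabolicP => i j.
rewrite glDE glZE; have [->|/xP//] := eqVneq (x i j) 0.
by rewrite mulr0 add0r => /yP.
Qed.

Fact parabolic_lie x y :
  parabolic_set x -> parabolic_set y -> parabolic_set (lie x y).
Proof.
move=> /parabolicP xP /parabolicP yP; apply/parabolicP => i j.
rewrite glDE glNE; have [->|] := eqVneq (glmul x y i j) 0.
  rewrite add0r oppr_eq0 => /glmul_mx_neq0[k [yk xk]] Sj.
  by apply: (yP _ k) => //; exact: xP Sj.
move=> /glmul_mx_neq0[k [xk yk]] _ Sj.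
by apply: (xP _ k) => //; exact: yP Sj.
Qed.

Definition parabolic : subLie glinf := SubLie parabolic_subspace parabolic_lie.

(* The projection of gl_oo^(S,+) + gl_S onto gl_S along gl_oo^(S,+); making
   gl_oo^(S,+) act trivially on a gl_S-module is pulling back along it. *)
Definition proj_glS (x : sl_alg parabolic) : sl_alg glS :=
  sl_mk (block_glS (sl_val x)).

Lemma proj_glS_id x : sl_set glS (sl_val x) -> sl_val (proj_glS x) = sl_val x.
Proof.
move=> /espanP xP; apply: gl_ext => i j /=; rewrite /block_mx.
case: asboolP => // nS; apply/esym/eqP; move/contra_notT: (xP i j).
exact.
Qed.

Lemma proj_glS_plus x : sl_set glplus (sl_val x) -> proj_glS x = 0.
Proof.
move=> /espanP xP; apply: sl_val_inj; rewrite sl_val0.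
apply: gl_ext => i j /=; rewrite /block_mx; case: asboolP => // -[_ Sj].
by apply/eqP; move/contra_notT: (xP i j); apply => /(_ Sj).
Qed.

Lemma proj_glS_hom : is_lie_hom proj_glS.
Proof.
have blockM (x y : glinf) i j : (forall k l, x k l != 0 -> S l -> S k) ->
    (forall k l, y k l != 0 -> S l -> S k) -> S i -> S j ->
    glmul (block x) (block y) i j = glmul x y i j.
  move=> xP yP Si Sj; apply: eq_fsbigr => k _ /=; rewrite /block_mx.
  have [Sk|nSk] := pselect (S k); first by rewrite !ifT //; apply/asboolP.
  have -> : y k j = 0 by apply: contra_notP nSk => /eqP/yP; apply.
  by rewrite mulr0; case: ifP => _; case: ifP => _; rewrite ?mulr0.
split=> [a x y|x y]; apply: sl_val_inj.
  rewrite sl_valD; apply: gl_ext => i j; rewrite glDE glZE /= /block_mx.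
  case: ifP => _; last by rewrite mulr0 addr0.
  by rewrite glDE glZE.
have /parabolicP xP := sl_mem x; have /parabolicP yP := sl_mem y.
change (block (lie (sl_val x) (sl_val y)) =
        lie (block (sl_val x)) (block (sl_val y))).
move: (sl_val x) (sl_val y) xP yP => {}x {}y xP yP.
have block0 (u v : glinf) i j : ~ (S i /\ S j) ->
    glmul (block u) (block v) i j = 0.
  move=> nS; apply/eqP; apply: contra_notT nS => /glmul_mx_neq0[k []].
  have /espanP bu := block_glS u; have /espanP bv := block_glS v.
  by move=> /bu[Si _] /bv[].
apply: gl_ext => i j; rewrite gl_lieE.
have -> : block (lie x y) i j = block_mx (lie x y) i j by [].
rewrite /block_mx; case: asboolP => [[Si Sj]|nS].
  by rewrite gl_lieE (blockM x y) // (blockM y x).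
by rewrite (block0 x y) // (block0 y x) // subrr.
Qed.

Lemma HS_sub_Hfull : sl_set HS `<=` sl_set Hfull.
Proof. by move=> x /espanP xP; apply/espanP => i j /xP[]. Qed.

Lemma HS_sub_glS : sl_set HS `<=` sl_set glS.
Proof. by move=> x /espanP xP; apply/espanP => i j /xP[->]. Qed.

Definition restrict_HS (lam : {linear sl_type Hfull -> C^o}) :
    {linear sl_type HS -> C^o} :=
  lam \o sl_incl HS_sub_Hfull.

Definition glS_pos : set glinf := espan (fun m n => [/\ S m, S n & m < n]).

Definition irreducible_highest_weight (mu : {linear sl_type HS -> C^o})
    (V : lieModule (sl_alg glS)) : Prop :=
  irreducible V /\
  exists v : V,
    [/\ v <> 0,
        forall x : sl_alg glS, glS_pos (sl_val x) -> act x v = 0,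
        forall h : sl_type HS,
          act (sl_incl HS_sub_glS h : sl_alg glS) v = (mu h : C) *: v &
        forall N : submodule V, sm_set N v -> (N : set V) = setT].

Definition Mmod (V : lieModule (sl_alg glS)) : lieModule glinf :=
  induced_module (pullback proj_glS_hom V).

(* Lmod V is L(S, lambda) when V is the irreducible highest weight gl_S-module
   L(lambda_S). *)
Definition Lmod (V : lieModule (sl_alg glS)) : lieModule glinf :=
  irr_quotient (Mmod V).

End FixS.

Definition supp (lam : {linear sl_type Hfull -> C^o}) : set int :=
  [set m | lam (Ediag m) != 0].

Definition Pplus (S : set int) (lam : {linear sl_type Hfull -> C^o}) : Prop :=
  [/\ forall i, exists k : nat, lam (Ediag i) = k%:R,
      forall i, ~ S i -> lam (Ediag i) = 0 &
      forall i j, S i -> S j -> i < j ->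
        (lam (Ediag j) : C) <= (lam (Ediag i) : C)].

Definition in_C (W : lieModule glinf) : Prop :=
  forall w : W, exists2 T : set int, finite_set T &
    forall m n, ~ T n -> act (Emat m n) w = 0.

(* W is the sum (automatically direct) of the eigenspaces of x, as usual for
   semisimple actions over an algebraically closed field, including in infinite
   dimension. *)
Definition acts_semisimply (W : lieModule glinf) (x : glinf) : Prop :=
  forall w : W, span [set v : W | exists a : C, act x v = a *: v] w.

Definition acts_locally_nilpotently (W : lieModule glinf) (x : glinf) : Prop :=
  forall w : W, exists k : nat, iter k (act x) w = 0.

Definition integrable (W : lieModule glinf) : Prop :=
  (forall n, acts_semisimply W (Emat n n)) /\
  (forall p q, p != q -> acts_locally_nilpotently W (Emat p q)).

Definition in_Cint (W : lieModule glinf) : Prop := in_C W /\ integrable W.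

End GlInf.

(* Main.v *)
Require Import Defs.
From HB Require Import structures.
From mathcomp Require Import all_boot all_order all_algebra.
From mathcomp Require Import boolp classical_sets functions cardinality reals complex.
From mathcomp Require Import zify ring.

(* A highest weight module over gl_oo with respect to S is generated by a
   vector v0, and a suitable diagonal element D grades it with top degree C v0.
   Hence a submodule avoiding v0 lies in strictly lower degrees: this gives the
   irreducible quotient and its uniqueness without the PBW theorem.

   When lambda is dominant, order the indices as r < ... < n < j for some j
   outside S.  For adjacent indices i < k in this order, E_{k,i}^(a+1) v0 with
   a = lambda_i - lambda_k is singular of lower degree, hence zero in the
   irreducible quotient; commutators in Heisenberg triples then make every
   E_{p,q} act nilpotently on v0, and local nilpotency spreads from v0 to the
   module it generates.

   Conversely, a nonzero vector killed by all E_{m,k} with k outside some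
   interval S can be turned, by local nilpotency and semisimplicity, into a
   highest weight vector v.  Its weight is dominant by sl_2 theory, the indices
   outside S forcing nonnegativity.  The gl_S-module generated by v is the
   top-degree part of the module, so it is irreducible, and the induced map from
   M(S, -) is the irreducible quotient. *)

Set Implicit Arguments.
Unset Strict Implicit.
Unset Printing Implicit Defensive.

Import Order.TTheory GRing.Theory Num.Theory.

Local Open Scope classical_set_scope.
Local Open Scope ring_scope.

(* Not the span of a sequence of vectors from [vector]. *)
Local Notation span := Defs.span.

(** * Subspaces, submodules and quotients *)

Section Subspaces.
Variables (K : fieldType) (V : lmodType K).
Implicit Types (N F : set V).

Lemma subspaceD N x y : is_subspace N -> N x -> N y -> N (x + y).
Proof. by move=> [_ NN] Nx Ny; rewrite -[x]scale1r; apply: NN. Qed.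

Lemma subspaceZ N a x : is_subspace N -> N x -> N (a *: x).
Proof. by move=> [N0 NN] Nx; rewrite -[_ *: _]addr0; apply: NN. Qed.

Lemma subspaceB N x y : is_subspace N -> N x -> N y -> N (x - y).
Proof.
by move=> NS Nx Ny; apply: subspaceD => //; rewrite -scaleN1r; apply: subspaceZ.
Qed.

Lemma subspace_line (v : V) : is_subspace [set x | exists a, x = a *: v].
Proof.
split=> [|a _ _ [b ->] [c ->]]; first by exists 0; rewrite scale0r.
by exists (a * b + c); rewrite scalerDl scalerA.
Qed.

Lemma subspace_sum_sub N F :
  is_subspace N -> is_subspace F -> is_subspace (sum_sub N F).
Proof.
move=> NS FS; split.
  by exists 0, 0; rewrite addr0; split=> //; [exact: NS.1|exact: FS.1].
move=> a _ _ [x [y [Nx Fy ->]]] [x' [y' [Nx' Fy' ->]]].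
exists (a *: x + x'), (a *: y + y'); split; [exact: NS.2|exact: FS.2|].
by rewrite scalerDr addrACA.
Qed.

End Subspaces.

Section ModuleTheory.
Variables (K : fieldType) (g : lieAlgType K).
Implicit Types (M W : lieModule g).

Lemma act_0l M (v : M) : act 0 v = 0.
Proof. by have := act_linearl (-1) 0 0 v; rewrite scaler0 addr0 scaleN1r addNr. Qed.

Lemma actDr M x (v w : M) : act x (v + w) = act x v + act x w.
Proof. by have := act_linearr 1 x v w; rewrite !scale1r. Qed.

Lemma actZr M a x (v : M) : act x (a *: v) = a *: act x v.
Proof. by have := act_linearr a x v 0; rewrite !act0 !addr0. Qed.

Lemma actDl M x y (v : M) : act (x + y) v = act x v + act y v.
Proof. by have := act_linearl 1 x y v; rewrite !scale1r. Qed.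

Lemma actZl M a x (v : M) : act (a *: x) v = a *: act x v.
Proof. by have := act_linearl a x 0 v; rewrite !act_0l !addr0. Qed.

Lemma act_suml M I (s : seq I) (F : I -> g) (v : M) :
  act (\sum_(i <- s) F i) v = \sum_(i <- s) act (F i) v.
Proof.
by elim: s => [|i s IH]; rewrite ?big_nil ?act_0l // !big_cons actDl IH.
Qed.

Lemma act_comm M x y (v : M) : act x (act y v) = act y (act x v) + act (lie x y) v.
Proof. by rewrite act_lie addrC subrK. Qed.

Lemma lie_0l (x : g) : lie 0 x = 0.
Proof. by have := lie_linearl (-1) 0 0 x; rewrite scaler0 addr0 scaleN1r addNr. Qed.

Lemma lieZl a (x y : g) : lie (a *: x) y = a *: lie x y.
Proof. by have := lie_linearl a x 0 y; rewrite lie_0l !addr0. Qed.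

Lemma lieDl (x y z : g) : lie (x + y) z = lie x z + lie y z.
Proof. by have := lie_linearl 1 x y z; rewrite !scale1r. Qed.

Lemma lieDr (x y z : g) :
  lie x (y + z) = lie x y + lie x z.
Proof. by have := lie_linearr 1 x y z; rewrite !scale1r. Qed.

Lemma lie_antisym (x y : g) :
  lie x y = - lie y x.
Proof.
have := liexx (x + y); rewrite lieDl !lieDr !liexx addr0 add0r => /eqP.
by rewrite addr_eq0 => /eqP.
Qed.

Lemma lie_suml I (s : seq I) (F : I -> g) z :
  lie (\sum_(i <- s) F i) z = \sum_(i <- s) lie (F i) z.
Proof.
by elim: s => [|i s IH]; rewrite ?big_nil ?lie_0l // !big_cons lieDl IH.
Qed.

Lemma sum_submodule M (N N' : submodule M) :
  exists P : submodule M, sm_set P = sum_sub N N'.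
Proof.
have PS := subspace_sum_sub (sm_subspace N) (sm_subspace N').
unshelve eexists (@Submodule K g M _ PS _) => // x _ [y [z [Ny Nz ->]]].
by exists (act x y), (act x z); rewrite actDr; split=> //; exact: sm_act.
Qed.

Lemma submodule_full M (N : submodule M) v :
  (forall P : submodule M, sm_set P v -> sm_set P = setT) ->
  sm_set N v -> forall x, sm_set N x.
Proof. by move=> gen /gen -> x. Qed.

Lemma irreducible_generated M v : irreducible M -> v <> 0 ->
  forall N : submodule M, sm_set N v -> sm_set N = setT.
Proof. by move=> [_ irr] v0 N Nv; case: (irr N) => // N0; rewrite N0 in Nv. Qed.

(** The image of [P] in the irreducible quotient is zero or everything. It misses the class of [v]:
    a representative in [P] would differ from [v] by an element of [N], hence of [P]. *)
Lemma quot_irreducible_maximal M (N P : submodule M) (v : M) :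
  irreducible (quot_module N) -> N `<=` P -> ~ sm_set P v -> P `<=` N.
Proof.
move=> [_ irr] NP nPv.
pose Q : set (quot_module N) := [set u | exists2 p, sm_set P p & u = qpi N p].
have QS : is_subspace Q.
  split=> [|a _ _ [p Pp ->] [q Pq ->]]; first by exists 0 => //; exact: (sm_subspace P).1.
  by exists (a *: p + q); [exact: (sm_subspace P).2|rewrite qpi_linear].
have Qact x u : Q u -> Q (act x u).
  by move=> [p Pp ->]; exists (act x p); [exact: sm_act|rewrite -(qpi_hom N).2].
have [/= Q0|/= QT] := irr (Submodule QS Qact).
  move=> p Pp; have : Q (qpi N p) by exists p.
  by rewrite Q0 /= => /(qpiP N p 0); rewrite subr0.
have [p Pp /qpiP/NP Pvp] : Q (qpi N v) by rewrite QT.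
by case: nPv; rewrite -(subrK p v); exact: subspaceD (sm_subspace P) _ _.
Qed.

End ModuleTheory.

(** * Gradings by the eigenvalues of one element *)

Section Below.
Variables (K : numFieldType) (g : lieAlgType K) (M : lieModule g) (D : g).
Implicit Types (d : K) (v w : M) (N X : set M).

(** The sum of the [D]-eigenspaces whose eigenvalue is [d] minus a positive integer, that is, the
    part of degree strictly below [d]. *)
Definition below d : set M :=
  span [set x | exists k : nat, act D x = (d - k.+1%:R) *: x].

Lemma below_subspace d : is_subspace (below d).
Proof. exact: span_subspace. Qed.

Lemma eigen_below d (k : nat) x : act D x = (d - k.+1%:R) *: x -> below d x.
Proof. by move=> Dx; apply: Defs.sub_span; exists k. Qed.

Lemma act_eigen a b (y : g) v :
  act D v = a *: v -> lie D y = b *: y -> act D (act y v) = (a + b) *: act y v.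
Proof.
by move=> Dv Dy; rewrite act_comm Dv Dy actZr actZl -scalerDl.
Qed.

Lemma below_trans d (k : nat) w : below (d - k%:R) w -> below d w.
Proof.
move=> bw; apply: bw; first exact: below_subspace.
move=> x [j Dx]; apply: (@eigen_below _ (k + j)); rewrite Dx; congr (_ *: _).
by rewrite -addrA -opprD -natrD addnS.
Qed.

Lemma act_below d (y : g) (j : nat) w :
  lie D y = - j%:R *: y -> below d w -> below d (act y w).
Proof.
move=> Dy bw; apply: (bw [set w | below d (act y w)]).
  split=> [|a x z bx bz] /=; first by rewrite act0; exact: (below_subspace _).1.
  by rewrite act_linearr; apply: (below_subspace _).2.
move=> x [k Dx] /=; apply: (@eigen_below _ (k + j)).
by rewrite (act_eigen Dx Dy); congr (_ *: _); rewrite -addnS natrD; ring.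
Qed.

(** The product of the operators [D - a], for [a] in [s], applied to [v]. *)
Fixpoint kill_eigen (s : seq K) v : M :=
  if s is a :: s' then act D (kill_eigen s' v) - a *: kill_eigen s' v else v.

Lemma kill_eigen_linear s a v w :
  kill_eigen s (a *: v + w) = a *: kill_eigen s v + kill_eigen s w.
Proof.
elim: s => //= b s ->; rewrite act_linearr scalerDr scalerBr !scalerA opprD.
by rewrite (mulrC b) addrACA.
Qed.

Lemma kill_eigen0 s : kill_eigen s 0 = 0.
Proof. by elim: s => //= a s ->; rewrite act0 scaler0 subrr. Qed.

Lemma kill_eigen_cat s t v :
  kill_eigen (s ++ t) v = kill_eigen s (kill_eigen t v).
Proof. by elim: s => //= a s ->. Qed.

Lemma kill_eigen_comm s t v :
  kill_eigen s (kill_eigen t v) = kill_eigen t (kill_eigen s v).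
Proof.
have kD t' w : kill_eigen t' (act D w) = act D (kill_eigen t' w).
  by elim: t' w => //= a t' IH w; rewrite !IH actB actZr.
have kZ t' b w : kill_eigen t' (b *: w) = b *: kill_eigen t' w.
  by have := kill_eigen_linear t' b w 0; rewrite kill_eigen0 !addr0.
elim: s => //= a s IH; rewrite IH -scaleN1r scalerA -kD -kZ.
rewrite [in RHS]addrC -[act D (kill_eigen s v)]scale1r -scaleN1r scalerA.
by rewrite kill_eigen_linear addrC kZ scale1r mulN1r.
Qed.

Lemma eigen_span_killed (A : set K) w :
  span [set x : M | exists2 a, A a & act D x = a *: x] w ->
  exists2 s : seq K, forall a, a \in s -> A a & kill_eigen s w = 0.
Proof.
move=> sw; apply: (sw [set x | exists2 s : seq K, forall a, a \in s -> A a
  & kill_eigen s x = 0]) => [|x [a Aa Dx]]; last first.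
  by exists [:: a] => [b|]; [rewrite inE => /eqP->|rewrite /= Dx subrr].
split=> [|a x y [s sA sx] [t tA ty]]; first by exists [::].
exists (s ++ t); first by move=> b; rewrite mem_cat => /orP[/sA|/tA].
rewrite kill_eigen_linear !kill_eigen_cat (kill_eigen_comm _ _ x) ty.
by rewrite sx !kill_eigen0 scaler0 addr0.
Qed.

Lemma kill_eigen_stable N s v : is_subspace N ->
  (forall x, N x -> N (act D x)) -> N v -> N (kill_eigen s v).
Proof.
move=> NS ND Nv; elim: s => //= a s IH.
exact: (subspaceB NS (ND _ IH) (subspaceZ a NS IH)).
Qed.

(** Some product of factors [D - a] kills [v]. Applying the factors one at a time, the last nonzero
    vector is an eigenvector, and it is still in [N]. *)
Lemma eigenvector_in_subspace N v : is_subspace N ->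
  (forall x, N x -> N (act D x)) -> N v -> v <> 0 ->
  span [set x : M | exists a, act D x = a *: x] v ->
  exists x, [/\ N x, x <> 0 & exists a, act D x = a *: x].
Proof.
move=> NS ND Nv v0 sv.
have [s _ sv0] : exists2 s : seq K, forall a, a \in s -> setT a & kill_eigen s v = 0.
  apply: eigen_span_killed; move: sv; rewrite (_ : mkset _ = mkset (fun x : M =>
    exists2 a, setT a & act D x = a *: x)) //.
  by apply/seteqP; split=> x [a]; [exists a|move=> _; exists a].
elim: s sv0 => [//|a s IH] /= /eqP; rewrite subr_eq0 => /eqP Ds.
have [s0|/eqP s0] := eqVneq (kill_eigen s v) 0; first exact: IH.
by exists (kill_eigen s v); split=> //; [exact: kill_eigen_stable|exists a].
Qed.

(** The product of [D - a] over the eigenvalues [a = d - (k + 1)] occurring in [w] kills [w] and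
    multiplies [v] by a product of numbers [k + 1], which is invertible in characteristic 0. *)
Lemma below_component N d v w : is_subspace N ->
  (forall x, N x -> N (act D x)) -> act D v = d *: v ->
  below d w -> N (v + w) -> N v.
Proof.
move=> NS ND Dv bw Nvw.
have [s sA sw] : exists2 s : seq K, forall a, a \in s ->
    [set a | exists k : nat, a = d - k.+1%:R] a & kill_eigen s w = 0.
  apply: eigen_span_killed; apply: bw; first exact: span_subspace.
  by move=> x [k Dx]; apply: Defs.sub_span; eexists; [exists k|].
have [c c0 cE] : exists2 c : K, c != 0 & kill_eigen s v = c *: v.
  elim: s sA {sw} => [|a s IH] sA; first by exists 1; rewrite ?oner_eq0 ?scale1r.
  have [c c0 cE] := IH (fun b bs => sA b (@mem_behead _ (a :: s) b bs)).
  have [k aE] := sA a (mem_head _ _); exists (k.+1%:R * c).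
    by rewrite mulf_neq0 // pnatr_eq0.
  by rewrite /= cE actZr Dv !scalerA -scalerBl aE; congr (_ *: _); ring.
have := kill_eigen_stable s NS ND Nvw.
rewrite -[v]scale1r kill_eigen_linear scale1r sw addr0 cE.
by move=> /(subspaceZ c^-1 NS); rewrite scalerA mulVf // !scale1r.
Qed.

Lemma below_eigen0 d v : act D v = d *: v -> below d v -> v = 0.
Proof.
move=> Dv bv; have [N0 NN] : is_subspace [set (0 : M)].
  by split=> // a x y -> ->; rewrite scaler0 addr0.
apply: (@below_component [set 0] d v (- v)) => //.
- by move=> x ->; rewrite /= act0.
- by rewrite -scaleN1r; apply: subspaceZ bv; exact: span_subspace.
- exact: subrr.
Qed.

End Below.

(* The generated submodule is the closure [F] of [X] under [Y] alone: the set
   of [w] in [F] with [g w] inside [F] is again closed under [Y], because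
   [x (y w) = y (x w) + [x, y] w]. *)
Lemma cone_submodule (K : fieldType) (g : lieAlgType K) (M : lieModule g)
    (Y : set g) (X : set M) :
  is_subspace X ->
  (forall F : set M, is_subspace F -> X `<=` F ->
     (forall y w, Y y -> F w -> F (act y w)) ->
     forall x v, X v -> F (act x v)) ->
  exists N : submodule M, X `<=` N /\
    forall F : set M, is_subspace F -> X `<=` F ->
     (forall y w, Y y -> F w -> F (act y w)) -> N `<=` F.
Proof.
move=> XS HX; pose F : set M := [set v | forall F : set M, is_subspace F -> X `<=` F ->
  (forall y w, Y y -> F w -> F (act y w)) -> F v].
have FS : is_subspace F.
  split=> [G [G0 _] //|a x y Fx Fy G GS XG YG].
  by apply: GS.2; [exact: Fx|exact: Fy].
have XF : X `<=` F by move=> x Xx G _ XG _; exact: XG.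
have YF y w : Y y -> F w -> F (act y w).
  by move=> Yy Fw G GS XG YG; apply: (YG _ _ Yy); exact: Fw.
have Fact x v : F v -> F (act x v).
  pose G : set M := [set w | F w /\ forall x, F (act x w)].
  move=> Fv; suff /(_ v Fv) [_] : F `<=` G by [].
  move=> w; apply.
  - split; first by split=> [|z]; rewrite ?act0; exact: FS.1.
    move=> a y z [Fy gy] [Fz gz]; split=> [|u]; first exact: FS.2.
    by rewrite act_linearr; exact: FS.2.
  - move=> u Xu; split=> [|z]; first exact: XF.
    exact: HX.
  - move=> y u Yy [Fu gu]; split=> [|z]; first exact: YF.
    by rewrite act_comm; apply: (subspaceD FS) (gu _); exact: YF.
exists (@Submodule K g M F FS Fact).
split; first exact: XF.
by move=> G GS XG YG v Fv; exact: Fv.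
Qed.

(** * Irreducible quotients of a module generated by a vector of top degree *)

Section IrreducibleQuotients.
Variables (K : numFieldType) (g : lieAlgType K) (M : lieModule g).
Variables (D : g) (d : K) (v0 : M).
Hypothesis Dv0 : act D v0 = d *: v0.
Hypothesis gen : forall N : submodule M, sm_set N v0 -> sm_set N = setT.
Hypothesis dec : forall x : M, exists a, below D d (x - a *: v0).

(** If some element of [N] had a nonzero coefficient on [v0], [below_component] would extract [v0]
    from it. *)
Lemma proper_below (N : submodule M) : ~ sm_set N v0 -> N `<=` below D d.
Proof.
move=> nN x Nx; have [a bx] := dec x; have [a0|a0] := eqVneq a 0.
  by rewrite a0 scale0r subr0 in bx.
case: nN; apply: (@below_component _ _ _ D _ d v0 (a^-1 *: (x - a *: v0))) => //.
- exact: sm_subspace.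
- by move=> y; exact: sm_act.
- exact: subspaceZ (below_subspace M D d) bx.
- rewrite scalerBr scalerA mulVf // scale1r addrC subrK.
  exact: subspaceZ (sm_subspace N) _.
Qed.

(** The quotient is by the union of all submodules avoiding [v0]. This union is a submodule: two of
    its members lie below degree [d], hence so does their sum, which therefore avoids [v0] again. *)
Lemma irreducible_quotient_exists :
  v0 <> 0 -> exists N : submodule M, irreducible (quot_module N).
Proof.
move=> v0n; pose N := [set x : M | exists2 P : submodule M, sm_set P x & ~ sm_set P v0].
have NS : is_subspace N.
  split; first by exists (zero_submodule M).
  move=> a x y [P Px nP] [Q Qy nQ]; have [PQ PQE] := sum_submodule P Q.
  exists PQ; rewrite PQE.
    exists (a *: x), y; split=> //; exact: subspaceZ (sm_subspace P) _.
  move=> [p [q [Pp Qq v0E]]]; apply: v0n; apply: (below_eigen0 Dv0).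
  by rewrite v0E; apply: (subspaceD (below_subspace M D d)); [exact: (proper_below nP)
    |exact: (proper_below nQ)].
have Nact x v : N v -> N (act x v) by move=> [P Pv nP]; exists P => //; exact: sm_act.
pose NM := Submodule NS Nact; exists NM; split.
  exists (qpi NM v0) => /(qpiP NM v0 0); rewrite subr0 => -[P Pv]; exact.
move=> Q; pose P : set M := [set x | sm_set Q (qpi NM x)].
have PS : is_subspace P.
  split=> [|a x y Px Py]; first exact: (sm_subspace Q).1.
  by rewrite /P /= qpi_linear; exact: (sm_subspace Q).2.
have Pact x v : P v -> P (act x v).
  by rewrite /P /= => Pv; rewrite (qpi_hom NM).2; exact: sm_act.
have [Pv0|nP] := pselect (P v0).
  right; apply/seteqP; split=> // u _; have [x ->] := qpi_surj u.
  by have : (Submodule PS Pact : set M) x by rewrite (gen (N := Submodule PS Pact)).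
left; apply/seteqP; split=> [u Qu|_ ->]; last exact: (sm_subspace Q).1.
have [x xE] := qpi_surj u; rewrite xE in Qu *; apply/(qpiP NM x 0); rewrite subr0.
by exists (Submodule PS Pact).
Qed.

(** Uniqueness of the irreducible quotient: for degree reasons [N + P] still avoids [v0], so
    maximality of [N] forces [P] into [N]. *)
Lemma irreducible_quotient_maximal (N : submodule M) :
  irreducible (quot_module N) ->
  ~ sm_set N v0 /\ forall P : submodule M, ~ sm_set P v0 -> P `<=` N.
Proof.
move=> irrN; have nN : ~ sm_set N v0.
  move=> /gen NT; have [[u un] _] := irrN; apply: un; have [x ->] := qpi_surj u.
  by apply/(qpiP N x 0); rewrite NT.
have v0n : v0 <> 0 by move=> v0E; apply: nN; rewrite v0E; exact: (sm_subspace N).1.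
split=> // P nP; have [Q QE] := sum_submodule N P.
apply: (@subset_trans _ Q).
  by move=> x Px; rewrite QE; exists 0, x; rewrite add0r; split=> //; exact: (sm_subspace N).1.
apply: (quot_irreducible_maximal (v := v0)) => //.
  by move=> x Nx; rewrite QE; exists x, 0; rewrite addr0; split=> //; exact: (sm_subspace P).1.
rewrite QE => -[p [q [Np Pq v0E]]]; apply: v0n; apply: (below_eigen0 Dv0).
by rewrite v0E; apply: (subspaceD (below_subspace M D d)); [exact: (proper_below nN)
  |exact: (proper_below nP)].
Qed.

End IrreducibleQuotients.

(** * Local nilpotency *)

Section LocalNilpotency.
Variables (K : numFieldType) (g : lieAlgType K) (M : lieModule g).
Implicit Types (x y z e f h : g) (v w : M).

Lemma iter_act_linear x k a v w :
  iter k (act x) (a *: v + w) = a *: iter k (act x) v + iter k (act x) w.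
Proof. by elim: k => //= k ->; rewrite act_linearr. Qed.

Lemma iter_act0 x k : iter k (act x) (0 : M) = 0.
Proof. by elim: k => //= k ->; rewrite act0. Qed.

Lemma iter_act_ge x k l v :
  iter k (act x) v = 0 -> (k <= l)%N -> iter l (act x) v = 0.
Proof. by move=> kv /subnK <-; rewrite iterD kv iter_act0. Qed.

Lemma iter_act_comm x y k v :
  lie x y = 0 -> act x (iter k (act y) v) = iter k (act y) (act x v).
Proof. by move=> xy; elim: k => //= k <-; rewrite act_comm xy act_0l addr0. Qed.

Lemma iter_act_eigen x y a b k v : act x v = a *: v -> lie x y = b *: y ->
  act x (iter k (act y) v) = (a + k%:R * b) *: iter k (act y) v.
Proof.
move=> xv xy; elim: k => [|k IH]; first by rewrite mul0r addr0.
by rewrite iterS (act_eigen IH xy) -natr1; congr (_ *: _); ring.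
Qed.

Definition nil_vectors x : set M := [set v | exists k, iter k (act x) v = 0].

Lemma nil_vectors_iter x v k : iter k (act x) v = 0 -> nil_vectors x v.
Proof. by exists k. Qed.

Lemma nil_vectors_subspace x : is_subspace (nil_vectors x).
Proof.
split=> [|a v w [k kv] [l lw]]; first by exists 0%N.
exists (k + l)%N; rewrite iter_act_linear.
by rewrite (iter_act_ge kv) ?leq_addr // (iter_act_ge lw) ?leq_addl // scaler0 addr0.
Qed.

(** Double induction through [x (y v) = y (x v) + [x, y] v]: the first term lowers the nilpotency
    order of [x] on [v], the second that of [ad x] on [y]. *)
Lemma nil_vectors_act x y v : (exists j, iter j (lie x) y = 0) ->
  nil_vectors x v -> nil_vectors x (act y v).
Proof.
move=> [j]; elim: j y v => [|j IH] y v /=.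
  by move=> -> _; rewrite act_0l; exact: (nil_vectors_subspace x).1.
move=> jy [k]; elim: k v => [|k IHk] v.
  by move=> /= ->; rewrite act0; exact: (nil_vectors_subspace x).1.
rewrite iterSr => kv; suff [l lw] : nil_vectors x (act x (act y v)).
  by exists l.+1; rewrite iterSr.
rewrite act_comm; apply: (subspaceD (nil_vectors_subspace x)); first exact: IHk.
apply: IH; last by exists k.+1; rewrite iterSr.
by rewrite -iterSr.
Qed.

(* In a Heisenberg triple, commuting [y] past [x^k = 0] trades one factor [x]
   for a factor [z], until [z^k = 0]. *)
Lemma nil_vectors_heisenberg x y z :
  lie x y = z -> lie x z = 0 -> lie y z = 0 ->
  (forall v, nil_vectors x v) -> (forall v, nil_vectors y v) ->
  forall v, nil_vectors z v.
Proof.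
move=> xy xz yz nx ny v; have [J Jv] := ny v.
(* Only finitely many vectors [y^t v] are nonzero, so a single exponent [k] serves for all of
   them. *)
have [k kv] : exists k, forall t, iter k (act x) (iter t (act y) v) = 0.
  suff [k kv] : exists k, forall t, (t < J)%N -> iter k (act x) (iter t (act y) v) = 0.
    exists k => t; have [/kv//|Jt] := ltnP t J.
    by rewrite (iter_act_ge Jv Jt) iter_act0.
  elim: J {Jv} => [|J [k kv]]; first by exists 0%N.
  have [l lv] := nx (iter J (act y) v); exists (k + l)%N => t.
  rewrite ltnS leq_eqVlt => /orP[/eqP ->|/kv kt].
    exact: iter_act_ge lv (leq_addl _ _).
  exact: iter_act_ge kt (leq_addr _ _).
exists k; suff /(_ k (leqnn k) 0%N) : forall i, (i <= k)%N -> forall t,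
  iter (k - i) (act x) (iter i (act z) (iter t (act y) v)) = 0 by rewrite subnn.
elim=> [_ t|i IH ik t]; first by rewrite subn0 /= kv.
have yx m (u : M) : act y (iter m.+1 (act x) u) =
    iter m.+1 (act x) (act y u) - m.+1%:R *: iter m (act x) (act z u).
  have zx (u' : M) : act y (act x u') = act x (act y u') - act z u'.
    by rewrite -xy act_lie opprB addrC subrK.
  elim: m u => [|m IHm] u; first by rewrite /= zx scale1r.
  rewrite iterS zx IHm actB actZr.
  rewrite (@iter_act_comm z x m.+1 u); last by apply/eqP; rewrite -oppr_eq0 -lie_antisym xz.
  by rewrite -addrA -opprD -[in RHS]natr1 scalerDl scale1r.
have /(_ t) IHt := IH (ltnW ik); have /(_ t.+1) IHt1 := IH (ltnW ik).
move: IHt IHt1; rewrite -(subnSK ik); set m := (k - i.+1)%N => IHt IHt1.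
have := yx m (iter i (act z) (iter t (act y) v)).
rewrite IHt act0 iter_act_comm // -iterS IHt1 sub0r => /esym/eqP.
by rewrite oppr_eq0 scaler_eq0 pnatr_eq0 /= => /eqP.
Qed.

Section Sl2.
Variables (e f h : g) (a : K) (v : M).
Hypotheses (ef : lie e f = h) (hf : lie h f = - 2 *: f).
Hypotheses (ev : act e v = 0) (hv : act h v = a *: v).

(** The coefficient vanishes at [k = a]. This makes [f^(a+1) v] singular, and conversely makes [a] a
    natural number once [f] is nilpotent on [v]. *)
Lemma sl2_raise k :
  act e (iter k.+1 (act f) v) = (k.+1%:R * (a - k%:R)) *: iter k (act f) v.
Proof.
elim: k => [|k IH]; first by rewrite /= act_comm ev act0 ef hv add0r; congr (_ *: _); ring.
rewrite iterS act_comm IH actZr ef (iter_act_eigen _ hv hf) -iterS -scalerDl.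
by rewrite -!natr1; congr (_ *: _); ring.
Qed.

(** Apply [sl2_raise] at the least power of [f] killing [v]: the left side is 0 while the vector on
    the right is not. *)
Lemma sl2_weight_nat : v <> 0 -> nil_vectors f v -> exists k : nat, a = k%:R.
Proof.
move=> v0 [k0 k0v]; pose P k := iter k (act f) v == 0.
have [] := @ex_minnP P (ex_intro _ k0 (introT eqP k0v)) => -[|k] /eqP kv kmin.
  by case: v0.
exists k; apply/eqP; rewrite -subr_eq0; have := sl2_raise k; rewrite kv act0.
move/esym/eqP; rewrite scaler_eq0 mulf_eq0 pnatr_eq0 /= => /orP[//|kv0].
by have := kmin k kv0; rewrite ltnn.
Qed.

End Sl2.

End LocalNilpotency.

(** * Highest weight vectors and singular vectors *)

Section GlInfinity.
Variable R : realType.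
Local Notation C := R[i].
Local Notation gl := (glinf R).
Local Notation E := (Emat R).

Lemma gl_ind (N : set gl) :
  is_subspace N -> (forall m n, N (E m n)) -> forall x, N x.
Proof.
move=> NS NE x; have : espan (fun _ _ => True) x by apply/espanP.
by apply=> // _ [m [n [_ ->]]].
Qed.

Lemma submodule_Emat (M : lieModule gl) (N : set M) : is_subspace N ->
  (forall m n v, N v -> N (act (E m n) v)) -> forall x v, N v -> N (act x v).
Proof.
move=> NS NE x v Nv; apply: (@gl_ind [set x | N (act x v)]) => [|m n]; last exact: NE.
split=> [|a y z Ny Nz] /=; first by rewrite act_0l; exact: NS.1.
by rewrite act_linearl; apply: NS.2.
Qed.

Lemma lie_diag k p q : lie (E k k) (E p q) = ((k == p)%:R - (k == q)%:R) *: E p q.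
Proof.
rewrite lieEE scalerBl; congr (_ - _); first by case: eqVneq => [->//|_]; rewrite !scale0r.
by case: eqVneq => [->//|_]; rewrite !scale0r.
Qed.

Lemma lie_sl2_ef i j : lie (E i j) (E j i) = E i i - E j j.
Proof. by rewrite lieEE !eqxx !scale1r. Qed.

Lemma lie_sl2_hf i j : i != j -> lie (E i i - E j j) (E j i) = - 2 *: E j i.
Proof.
move=> ij; rewrite addrC -scaleN1r lie_linearl !lieEE !eqxx (negPf ij) eq_sym (negPf ij).
by rewrite !scale1r !scale0r subr0 sub0r scaleN1r scaleNr scaler_nat mulr2n opprD.
Qed.

(** The grading element: for [w] supported in [s] it gives [E_{m,k}] the degree [w m - w k]. All
    indices outside [s] share level 0, which keeps the sum finite. *)
Definition weight_diag (w : int -> nat) (s : seq int) : gl :=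
  \sum_(k <- s) (w k)%:R *: E k k.

Lemma lie_weight_diag w s m k : uniq s -> (forall p, w p != 0%N -> p \in s) ->
  lie (weight_diag w s) (E m k) = ((w m)%:R - (w k)%:R) *: E m k.
Proof.
move=> us ws.
have wq q : \sum_(p <- s) (w p)%:R * (p == q)%:R = (w q)%:R :> C.
  have [qs|qs] := boolP (q \in s).
    rewrite (bigD1_seq q) //= eqxx mulr1 big1 ?addr0 // => p /negPf->.
    by rewrite mulr0.
  rewrite big_seq big1 => [|p ps].
    by have [->//|/ws] := eqVneq (w q) 0%N; rewrite (negPf qs).
  by case: eqVneq ps qs => [-> ->//|_ _ _]; rewrite mulr0.
rewrite lie_suml -(wq m) -(wq k) -sumrB scaler_suml; apply: eq_bigr => p _.
rewrite lieZl lieEE scalerBr !scalerA scalerBl.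
congr (_ - _).
  by have [->//|_] := eqVneq p m; rewrite mulr0 !scale0r.
by have [->//|_] := eqVneq p k; rewrite mulr0 !scale0r.
Qed.

(** The off-diagonal units of degree 0 must also kill [v], so that units not lowering the degree
    preserve the line of [v]. *)
Definition hw_vector (w : int -> nat) (M : lieModule gl) (v : M) : Prop :=
  (forall m k, m != k -> (w k <= w m)%N -> act (E m k) v = 0) /\
  (forall k, exists a : C, act (E k k) v = a *: v).

Lemma weight_diag_eigen w s (M : lieModule gl) (v : M) :
  hw_vector w v -> exists d : C, act (weight_diag w s) v = d *: v.
Proof.
move=> [_ /choice[a av]]; exists (\sum_(k <- s) (w k)%:R * a k).
rewrite act_suml scaler_suml; apply: eq_bigr => k _.
by rewrite actZl av scalerA.
Qed.

(** * Submodules generated from a single degree *)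

Section Cone.
Variables (w : int -> nat) (s : seq int).
Hypotheses (us : uniq s) (ws : forall p, w p != 0%N -> p \in s).
Variable M : lieModule gl.
Local Notation D := (weight_diag w s).

(** This replaces the PBW theorem: each unit either preserves [X] or strictly lowers the degree, so
    by [cone_submodule] the lowering units alone generate the submodule from [X]. *)
Lemma parabolic_cone (d : C) (X : set M) : is_subspace X ->
  (forall x, X x -> act D x = d *: x) ->
  (forall m k x, (w k <= w m)%N -> X x -> X (act (E m k) x)) ->
  exists N : submodule M, X `<=` N /\ N `<=` sum_sub X (below D d).
Proof.
move=> XS XD XE.
pose Y := [set y | exists m k, (w m < w k)%N /\ y = E m k].
have [F FS XF YF x v Xv|N [XN NF]] := @cone_submodule _ _ M Y X XS.
  apply: (@gl_ind [set x | F (act x v)]) => [|m k] /=.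
    split=> [|a y z Fy Fz] /=; first by rewrite act_0l; exact: FS.1.
    by rewrite act_linearl; apply: FS.2.
  have [km|mk] := leqP (w k) (w m); first by apply/XF/XE.
  by apply: YF; [exists m, k|exact: XF].
have bS := below_subspace M D d.
exists N; split=> //; apply: NF; first exact: subspace_sum_sub.
  by move=> x Xx; exists x, 0; rewrite addr0; split=> //; exact: bS.1.
move=> _ _ [m [k [mk ->]]] [x [b [Xx bb ->]]].
have DE : lie D (E m k) = - (w k - w m)%:R *: E m k.
  by rewrite lie_weight_diag // natrB 1?ltnW // opprB.
(* The image has no [X] component: [x] drops by [w k - w m], at least 1, and [b] is already below
   degree [d]. *)
exists 0, (act (E m k) (x + b)); split; [exact: XS.1| |by rewrite add0r].
rewrite actDr; apply: (subspaceD bS); last exact: act_below DE bb.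
apply: (@eigen_below _ _ _ _ _ (w k - w m).-1).
by rewrite (act_eigen (XD _ Xx) DE) prednK ?subn_gt0.
Qed.

Lemma hw_cone (d : C) (v : M) : hw_vector w v -> act D v = d *: v ->
  exists N : submodule M, sm_set N v /\
    forall x, sm_set N x -> exists a, below D d (x - a *: v).
Proof.
move=> [kv /choice[a av]] Dv.
have [_ [b ->]|m k _ km [b ->]|N [XN NX]] := parabolic_cone (subspace_line v) (d := d).
- by rewrite actZr Dv !scalerA mulrC.
- have [->|mk] := eqVneq m k; first by exists (b * a k); rewrite actZr av scalerA.
  by exists 0; rewrite actZr kv // scaler0 scale0r.
exists N; split; first by apply: XN; exists 1; rewrite scale1r.
by move=> x /NX[_ [y [[b ->] by_ ->]]]; exists b; rewrite addrAC subrr add0r.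
Qed.

End Cone.

(** With [e = E_{p,q}], every term of the expansion of [(ad e)^3 x] contains the factor
    [e^2 = 0]. *)
Lemma Emat_square0 p q : p != q -> forall x, iter 3 (lie (E p q)) x = 0.
Proof.
move=> pq x; have EE : glmul (E p q) (E p q) = 0.
  by rewrite glmulEE eq_sym (negPf pq) scale0r.
have gm0 (y : gl) : glmul y 0 = 0.
  by have := glmulDr (-1) y 0 0; rewrite scaler0 addr0 scaleN1r addNr.
have g0m (y : gl) : glmul 0 y = 0.
  by have := glmulDl (-1) 0 0 y; rewrite scaler0 addr0 scaleN1r addNr.
have lieE (y z : gl) : lie y z = glmul y z - glmul z y by [].
have eey y : glmul (E p q) (glmul (E p q) y) = 0 by rewrite glmulA EE g0m.
have yee y : glmul (glmul y (E p q)) (E p q) = 0 by rewrite -glmulA EE gm0.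
have eeye y : glmul (E p q) (glmul (glmul (E p q) y) (E p q)) = 0.
  by rewrite glmulA eey g0m.
have eyee y : glmul (glmul (E p q) (glmul y (E p q))) (E p q) = 0.
  by rewrite -glmulA yee gm0.
by rewrite /= !lieE !(glmulBr, glmulBl) !(eey, yee, eeye, eyee, gm0, g0m) !subr0 ?subrr.
Qed.

(** As [ad E_{p,q}] is nilpotent, the vectors on which [E_{p,q}] is nilpotent form a submodule; it
    suffices that it contains the generator. *)
Lemma nil_Emat (M : lieModule gl) (v : M) p q : p != q ->
  (forall N : submodule M, sm_set N v -> sm_set N = setT) ->
  nil_vectors (E p q) v -> acts_locally_nilpotently M (E p q).
Proof.
move=> pq gen nv x; have Nact y w := @nil_vectors_act _ _ M (E p q) y w
  (ex_intro _ 3%N (Emat_square0 pq y)).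
have := submodule_full (N := Submodule (nil_vectors_subspace M (E p q)) Nact) gen nv x.
exact.
Qed.

(** * Singular vectors for adjacent indices *)

Section SingularVector.
Variables (w : int -> nat) (M : lieModule gl) (v : M) (i j : int) (a : nat).
Hypotheses (w_inj : forall m k, w m = w k -> (0 < w m)%N -> m = k).
Hypotheses (wij : w i = (w j).+1) (wj : (0 < w j)%N).
Hypothesis hwv : hw_vector w v.
Hypothesis weight_ij : act (E i i - E j j) v = (a%:R : C) *: v.

Lemma simple_neq : i != j.
Proof. by apply/eqP => ij; move: wij; rewrite ij => /eqP; rewrite eqn_leq ltnn andbF. Qed.

(** The exponent [a + 1] matters only for [E_{i,j}], where [sl2_raise] has coefficient 0; the other
    units kill every power of [E_{j,i}] on [v]. *)
Lemma singular_hw : hw_vector w (iter a.+1 (act (E j i)) v).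
Proof.
have ij := simple_neq; have [kv /choice[c cv]] := hwv; split; last first.
  by move=> k; eexists; exact: iter_act_eigen (cv k) (lie_diag _ _ _).
move=> m k mk wkm.
have [[-> ->]|mkij] := pselect (m = i /\ k = j).
  rewrite (sl2_raise (lie_sl2_ef i j) (lie_sl2_hf ij) _ weight_ij).
    by rewrite subrr mulr0 scale0r.
  by apply: kv => //; rewrite wij leqnSn.
(* The bracket [[E_{m,k}, E_{j,i}]] is [E_{m,i}] if [k = j] and [-E_{j,k}] if [m = i]. Since [w i]
   and [w j] are consecutive and [w] is injective on positive weights, these are again off-diagonal
   units that do not lower the degree, other than [E_{i,j}]. *)
elim: a.+1 m k mk wkm mkij => [|t IH] m k mk wkm mkij; first exact: kv.
rewrite iterS act_comm IH // act0 add0r lieEE.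
have [kj|kj] := eqVneq k j.
  have mi : m != i by apply/eqP => mi; apply: mkij.
  rewrite (negPf mi) scale0r subr0 scale1r; apply: IH => //.
    2: by case => /eqP; rewrite (negPf mi).
  rewrite wij ltn_neqAle -kj wkm andbT; apply: contra mk => /eqP wkm'.
  by apply/eqP; rewrite [RHS](w_inj wkm') // kj.
rewrite scale0r sub0r; have [mi|_] := eqVneq m i; last by rewrite scale0r oppr0 act_0l.
rewrite scale1r -scaleN1r actZl IH ?scaler0 //; first by rewrite eq_sym.
  rewrite -ltnS -wij -mi ltn_neqAle wkm andbT; apply: contra mk => /eqP wkm'.
  by apply/eqP/w_inj; rewrite // mi wij.
by case=> _ kj'; rewrite kj' eqxx in kj.
Qed.

(** The submodule generated by the singular vector lives in degrees at most [d - (a + 1)]; if it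
    were all of [M], the degree [d] vector [v] would vanish. The alternative [v = 0] serves the
    default branch of [irr_quotient]. *)
Lemma singular_eq0 (s : seq int) : uniq s -> (forall p, w p != 0%N -> p \in s) ->
  irreducible M \/ v = 0 -> iter a.+1 (act (E j i)) v = 0.
Proof.
move=> us ws [irr|->]; last exact: iter_act0.
have [d Dv] := weight_diag_eigen s hwv.
have DE : lie (weight_diag w s) (E j i) = -1 *: E j i.
  by rewrite lie_weight_diag // wij -natr1; congr (_ *: _); ring.
have Du := iter_act_eigen a.+1 Dv DE; rewrite mulrN1 in Du.
have [N [Nu Nb]] := hw_cone us ws singular_hw Du.
have [N0|NT] := irr.2 N; first by rewrite N0 in Nu.
have [c bc] : exists c, below (weight_diag w s) (d - a.+1%:R)
   (v - c *: iter a.+1 (act (E j i)) v) by apply: Nb; rewrite NT.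
suff -> : v = 0 by exact: iter_act0.
apply: (below_eigen0 Dv); rewrite -(subrK (c *: iter a.+1 (act (E j i)) v) v).
apply: (subspaceD (below_subspace _ _ _)); first exact: below_trans bc.
exact: subspaceZ (below_subspace _ _ _) (eigen_below Du).
Qed.

End SingularVector.

End GlInfinity.

(** * Integrability *)

Section Integrability.
Variable R : realType.
Local Notation C := R[i].
Local Notation gl := (glinf R).
Local Notation E := (Emat R).

Lemma interval_seq (r n : int) :
  exists2 s : seq int, uniq s & forall k : int, (k \in s) = (r <= k <= n).
Proof.
have [rn|nr] := lerP r n; last by exists [::] => // k; rewrite in_nil; lia.
exists [seq r + k%:Z | k <- iota 0 `|n - r|%N.+1].
  by rewrite map_inj_uniq ?iota_uniq // => x y; lia.
move=> k; apply/mapP/idP => [[t]|rkn]; first by rewrite mem_iota => ?; lia.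
by exists (absz (k - r)%R); rewrite ?mem_iota; lia.
Qed.

Section IntervalWeight.
Variables r n : int.

(* [interval_weight j] orders the indices as [r < ... < n < j < everything
   else]: any one [j] outside the interval can be made adjacent to [n]. *)
Definition interval_weight (j k : int) : nat :=
  if r <= k <= n then absz (n + 2 - k)%R else (k == j).

Lemma interval_weight_support j : exists2 s : seq int, uniq s &
  forall k, interval_weight j k != 0%N -> k \in s.
Proof.
have [s us sE] := interval_seq r n; exists (undup (j :: s)).
  exact: undup_uniq.
move=> k; rewrite mem_undup inE sE /interval_weight; case: ifP => _.
  by rewrite orbT.
by case: (k == j).
Qed.

Lemma interval_weight_inj j m k : ~~ (r <= j <= n) ->
  interval_weight j m = interval_weight j k -> (0 < interval_weight j m)%N -> m = k.
Proof.
rewrite /interval_weight => jI; case: ifPn => mI; case: ifPn => kI; first by lia.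
- by case: eqVneq => _; lia.
- by case: eqVneq => _; lia.
by case: (eqVneq m j) => [->|//]; case: eqVneq.
Qed.

(** The vector [v] is allowed to be zero, so that these data pass to every quotient. *)
Record interval_hw (lam : int -> C) (M : lieModule gl) (v : M) : Prop := {
  hw_out : forall m k : int, ~~ (r <= k <= n) -> act (E m k) v = 0;
  hw_up : forall m k : int, r <= m -> m < k -> k <= n -> act (E m k) v = 0;
  hw_diag : forall k : int, r <= k <= n -> act (E k k) v = lam k *: v;
  hw_gen : forall N : submodule M, sm_set N v -> sm_set N = setT
}.

(** Any [j] works: units with column outside the interval kill [v], and a unit with column inside
    and row outside lowers the degree. *)
Lemma interval_hw_vector j lam M v :
  @interval_hw lam M v -> hw_vector (interval_weight j) v.
Proof.
case=> v_out v_up v_diag _; split=> [m k mk|k].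
  rewrite /interval_weight; case: ifPn => [kI|kI _]; last exact: v_out.
  case: ifPn => [mI|mI] h; last by case: eqP h; lia.
  by apply: v_up; move/eqP: mk; lia.
have [kI|kI] := boolP (r <= k <= n); first by eexists; exact: v_diag.
by exists 0; rewrite scale0r v_out.
Qed.

End IntervalWeight.

Variables (r n : int) (M : lieModule gl) (v : M) (lam : int -> nat).
Hypothesis hwv : interval_hw r n (fun k => (lam k)%:R) v.
Hypothesis rn : r <= n.
Hypothesis lam_dec : forall i j : int, r <= i -> i < j -> j <= n -> (lam j <= lam i)%N.
Hypothesis irr : irreducible M \/ v = 0.

Let v_out := hw_out hwv.
Let v_up := hw_up hwv.
Let v_diag := hw_diag hwv.
Let gen := hw_gen hwv.

Lemma simple_nilpotent (i j : int) : r <= i <= n ->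
  j = i + 1 /\ j <= n \/ i = n /\ ~~ (r <= j <= n) ->
  acts_locally_nilpotently M (E j i).
Proof.
move=> iI ij; have ji : j != i by apply/eqP; lia.
apply: (nil_Emat _ gen) => //.
(* The auxiliary index must be outside the interval: [j] itself if it is, which makes it adjacent to
   [n], and otherwise [n + 1]. *)
pose j' := if r <= j <= n then n + 1 else j.
have j'E : j' = if r <= j <= n then n + 1 else j by [].
have j'I : ~~ (r <= j' <= n) by rewrite j'E; case: ifPn => // _; lia.
have [s us ws] := interval_weight_support r n j'.
(* The weight is [lam i - lam j], natural by dominance, or simply [lam i] when [j] is outside the
   interval. *)
have [a aE] : exists a : nat, act (E i i - E j j) v = (a%:R : C) *: v.
  rewrite addrC -scaleN1r act_linearl (v_diag iI).
  have [jI|jI] := boolP (r <= j <= n); last first.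
    by rewrite v_out // scaler0 add0r; eexists.
  exists (lam i - lam j)%N; rewrite v_diag // natrB; last by apply: lam_dec; lia.
  by rewrite scaleN1r addrC scalerBl.
apply: (@nil_vectors_iter _ _ _ _ _ a.+1).
apply: (singular_eq0 _ _ _ (interval_hw_vector j' hwv) aE us ws irr).
- by move=> m k; exact: interval_weight_inj.
- rewrite /interval_weight iI; case: ifPn => jI; first by lia.
  by have := j'E; rewrite (negPf jI) => ->; rewrite eqxx; lia.
- rewrite /interval_weight; case: ifPn => jI; first by lia.
  by have := j'E; rewrite (negPf jI) => ->; rewrite eqxx.
Qed.

(** The vectors killed by all but finitely many columns form a submodule: applying [E_{p,q}] adds at
    most the column [p]. *)
Lemma interval_in_C : in_C M.
Proof.
pose N := [set x : M | exists2 T : set int, finite_set T &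
  forall m k, ~ T k -> act (E m k) x = 0].
have NS : is_subspace N.
  split=> [|a x y [T Tf Tx] [U Uf Uy]]; first by exists set0 => // m k _; rewrite act0.
  exists (T `|` U); first by rewrite finite_setU.
  by move=> m k /not_orP[nT nU]; rewrite act_linearr Tx // Uy // scaler0 addr0.
have Nact : forall x y, N y -> N (act x y).
  apply: submodule_Emat => // p q x [T Tf Tx].
  exists (T `|` [set p]); first by rewrite finite_setU; split=> //; exact: finite_set1.
  move=> m k /not_orP[nT /eqP kp]; rewrite act_comm Tx // act0 add0r lieEE (negPf kp).
  by rewrite scale0r sub0r -scaleN1r !actZl Tx // !scaler0.
move=> w; apply: (submodule_full (N := Submodule NS Nact) gen).
exists [set k : int | r <= k <= n]; last by move=> m k /negP; exact: v_out.
have [s _ sE] := interval_seq r n; rewrite (_ : mkset _ = [set` s]).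
  exact: finite_seq.
by apply/seteqP; split=> k /=; rewrite sE.
Qed.

(** Every matrix unit is an eigenvector of [ad E_{k,k}], so the span of the eigenvectors of
    [E_{k,k}] is a submodule; it contains the generator [v]. *)
Lemma interval_semisimple (k : int) : acts_semisimply M (E k k).
Proof.
pose X := [set x : M | exists a : C, act (E k k) x = a *: x].
have Nact : forall x y, span X y -> span X (act x y).
  apply: submodule_Emat => [|p q x Xx]; first exact: span_subspace.
  apply: (Xx [set x | span X (act (E p q) x)]).
    have [X0 XX] := span_subspace X; split=> [|a y z Xy Xz] /=; first by rewrite act0.
    by rewrite act_linearr; exact: XX.
  move=> y [a ay] /=; apply: Defs.sub_span; eexists.
  exact: act_eigen ay (lie_diag _ _ _ _).
move=> w; apply: (submodule_full (N := Submodule (span_subspace X) Nact) gen).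
apply: Defs.sub_span; exact: (interval_hw_vector n hwv).2.
Qed.

Lemma nil_heisenberg (p q t : int) : p != q -> q != t -> p != t ->
  acts_locally_nilpotently M (E p q) -> acts_locally_nilpotently M (E q t) ->
  acts_locally_nilpotently M (E p t).
Proof.
move=> pq qt pt npq nqt.
apply: (nil_vectors_heisenberg (x := E p q) (y := E q t)) => //; rewrite lieEE.
- by rewrite eqxx (negPf pt) scale1r scale0r subr0.
- by rewrite eq_sym (negPf pq) (negPf pt) !scale0r subrr.
- by rewrite eq_sym (negPf pt) (negPf qt) !scale0r subrr.
Qed.

(** A unit that does not kill [v] outright is reached from the simple lowering units by Heisenberg
    commutators along [q, q + 1, ..., p]. *)
Lemma interval_nilpotent (p q : int) : p != q -> acts_locally_nilpotently M (E p q).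
Proof.
move=> pq; have killed : act (E p q) v = 0 -> acts_locally_nilpotently M (E p q).
  by move=> pqv; apply: (nil_Emat _ gen) => //; exact: (@nil_vectors_iter _ _ _ _ _ 1).
have [qI|qI] := boolP (r <= q <= n); last exact/killed/v_out.
have low (k : nat) : q + k%:Z + 1 <= n -> acts_locally_nilpotently M (E (q + k%:Z + 1) q).
  elim: k => [|k IH] qk; first by apply: simple_nilpotent => //; left; lia.
  apply: (@nil_heisenberg _ (q + k%:Z + 1)); try by apply/eqP; lia.
    by apply: simple_nilpotent; lia.
  by apply: IH; lia.
have [pI|pI] := boolP (r <= p <= n).
  have [pltq|qlep] := ltP p q; first by apply/killed/v_up; lia.
  have -> : p = q + (`|p - q|%N - 1)%N%:Z + 1 by move/eqP: pq; lia.
  by apply: low; move/eqP: pq; lia.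
(* For [p] outside the interval the chain goes from [q] up to [n], then from [n] to [p] in one
   simple step. *)
have [->|qn] := eqVneq q n; first by apply: simple_nilpotent; [lia|right].
apply: (@nil_heisenberg _ n) => //; try by apply/eqP; lia.
  by apply: simple_nilpotent; [lia|right].
have -> : n = q + (`|n - q|%N - 1)%N%:Z + 1 by move/eqP: qn; lia.
by apply: low; move/eqP: qn; lia.
Qed.

Lemma interval_in_Cint : in_Cint M.
Proof.
split; first exact: interval_in_C.
by split; [exact: interval_semisimple|exact: interval_nilpotent].
Qed.

End Integrability.

(** * Induced modules *)

Section InducedModules.
Variables (K : fieldType) (g : lieAlgType K).

Lemma upiD (s t : uterm K g) : upi (UAdd s t) = upi s + upi t.
Proof. exact/esym/uaddE. Qed.

Lemma upiM (s t : uterm K g) : upi (UMul s t) = upi s * upi t.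
Proof. exact/esym/umulE. Qed.

Lemma upi_scal (a : K) : upi (UScal _ a) = a%:A :> envel g.
Proof. exact/esym/umulr1. Qed.

Variables (p : subLie g) (V : lieModule (sl_alg p)).
Local Notation M := (induced_module V).

Lemma tensZ (u : envel g) (a : K) (v : V) : tens u (a *: v) = a *: (tens u v : M).
Proof.
have -> : a *: v = uact (upi (UScal _ a)) v by rewrite uactE.
rewrite -tensB uinclE upi_scal -scalerAr mulr1.
by rewrite [RHS]lmul_tens -scalerAl mul1r.
Qed.

Lemma tens_linear (u : envel g) a (v w : V) :
  tens u (a *: v + w) = a *: (tens u v : M) + tens u w.
Proof. by rewrite tensDr tensZ. Qed.

Lemma act_tens1 (x : sl_alg p) (v : V) :
  act (sl_val x) (tens 1 v : M) = tens 1 (act x v).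
Proof.
rewrite [LHS]lmul_tens mulr1 -[ugen _]mul1r.
have -> : ugen (sl_val x) = uincl (ugen x) by rewrite uinclE.
by rewrite tensB uactE.
Qed.

Lemma submodule_lmul (N : submodule M) u m : sm_set N m -> sm_set N (lmul u m).
Proof.
have [t ->] := upi_surj u; elim: t m => [x|a|s IHs t IHt|s IHs t IHt] m Nm.
- exact: (@sm_act _ _ M N x).
- by rewrite upi_scal; apply: (@subspaceZ _ M N a m); first exact: sm_subspace.
- rewrite upiD lmulDl; apply: (@subspaceD _ M N); first exact: sm_subspace.
    exact: IHs.
  exact: IHt.
- by rewrite upiM -lmulA; apply/IHs/IHt.
Qed.

Lemma induced_generated (N : submodule M) :
  (forall v, sm_set N (tens 1 v)) -> sm_set N = setT.
Proof.
move=> Nt; apply/seteqP; split=> // m _; have NS := sm_subspace N.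
elim/induced_ind: m => [u v||m m' Nm Nm'|m Nm].
- by rewrite -[u]mulr1 -lmul_tens; exact: submodule_lmul.
- exact: NS.1.
- exact: (@subspaceD _ M).
- by rewrite -[- m]scaleN1r; exact: (@subspaceZ _ M).
Qed.

End InducedModules.

Lemma quot_generated (K : fieldType) (g : lieAlgType K) (M : lieModule g) (v : M)
    (N : submodule M) :
  (forall P : submodule M, sm_set P v -> sm_set P = setT) ->
  forall P : submodule (quot_module N), sm_set P (qpi N v) -> sm_set P = setT.
Proof.
move=> gen P Pv; apply/seteqP; split=> // u _; have [x ->] := qpi_surj u.
pose Q : set M := [set x | sm_set P (qpi N x)].
have QS : is_subspace Q.
  split=> [|a y z Py Pz]; first exact: (sm_subspace P).1.
  by rewrite /Q /= qpi_linear; exact: (sm_subspace P).2.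
have Qact y w : Q w -> Q (act y w).
  by rewrite /Q /= => Pw; rewrite (qpi_hom N).2; exact: sm_act.
exact: (submodule_full (N := Submodule QS Qact) gen Pv).
Qed.

(** * The modules M(S, V) as highest weight modules *)

Section HighestWeight.
Variables (R : realType) (r n : int).
Local Notation C := R[i].
Local Notation gl := (glinf R).
Local Notation E := (Emat R).
Local Notation S := [set m : int | r <= m <= n].

Lemma interval_hw_quot lam M v (N : submodule M) :
  interval_hw r n lam v -> @interval_hw R r n lam (quot_module N) (qpi N v).
Proof.
case=> out up diag gen; split=> [m k kI|m k rm mk kn|k kI|]; last exact: quot_generated.
- by rewrite -(qpi_hom N).2 out.
- by rewrite -(qpi_hom N).2 up.
- by rewrite -(qpi_hom N).2 diag // -[_ *: v]addr0 qpi_linear addr0.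
Qed.

(** Supplies the hypotheses of the irreducible quotient lemmas; any auxiliary index of
    [interval_weight] would do. *)
Lemma interval_hw_dec lam M v : @interval_hw R r n lam M v -> exists D d,
  act D v = d *: v /\ forall x, exists a, below D d (x - a *: v).
Proof.
move=> hw; have [s us ws] := interval_weight_support r n n.
have hwv := interval_hw_vector n hw.
have [d Dv] := weight_diag_eigen s hwv.
have [N [Nv Nb]] := hw_cone us ws hwv Dv.
exists (weight_diag R (interval_weight r n n) s), d; split=> // x; apply: Nb.
by rewrite (hw_gen hw).
Qed.

Lemma interval_hw_in_Cint (lam : int -> nat) M v : r <= n ->
  (forall i j : int, r <= i -> i < j -> j <= n -> (lam j <= lam i)%N) ->
  @interval_hw R r n (fun k => (lam k)%:R) M v -> irreducible M \/ v = 0 -> in_Cint M.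
Proof. by move=> rn dec hw irr; exact: interval_in_Cint hw _ _ _. Qed.

Lemma mem_glS m k : S m -> S k -> sl_set (glS R S) (E m k).
Proof. by move=> Sm Sk; apply: Defs.sub_span; exists m, k. Qed.

Lemma parabolic_glS (x : gl) : sl_set (glS R S) x -> sl_set (parabolic R S) x.
Proof.
by move=> xS; exists 0, x; rewrite add0r; split=> //; exact: (span_subspace _).1.
Qed.

Lemma parabolic_glplus (x : gl) : sl_set (glplus R S) x -> sl_set (parabolic R S) x.
Proof.
by move=> xS; exists x, 0; rewrite addr0; split=> //; exact: (span_subspace _).1.
Qed.

Variable V : lieModule (sl_alg (glS R S)).

Definition top_vector (v : V) : Mmod V :=
  @tens _ _ _ (pullback (@proj_glS_hom R S) V) 1 v.

Lemma top_linear a v w :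
  top_vector (a *: v + w) = a *: top_vector v + top_vector w.
Proof. exact: (@tens_linear _ _ _ (pullback (@proj_glS_hom R S) V)). Qed.

Lemma top0 : top_vector 0 = 0.
Proof. by have := top_linear (-1) 0 0; rewrite scaler0 addr0 scaleN1r addNr. Qed.

Lemma topZ a v : top_vector (a *: v) = a *: top_vector v.
Proof. by rewrite -[a *: v]addr0 top_linear top0 addr0. Qed.

Lemma Mmod_glS (x : sl_alg (glS R S)) (v : V) :
  act (sl_val x) (top_vector v) = top_vector (act x v).
Proof.
have xp := parabolic_glS (sl_mem x).
rewrite -[sl_val x]/(sl_val (sl_mk xp)).
rewrite [LHS](@act_tens1 _ _ _ (pullback (@proj_glS_hom R S) V)) /=.
congr (top_vector (act _ _)).
by apply: sl_val_inj; rewrite proj_glS_id //; exact: sl_mem.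
Qed.

Lemma Mmod_out (m k : int) (v : V) : ~~ (r <= k <= n) ->
  act (E m k) (top_vector v) = 0.
Proof.
move=> kI; have xE : sl_set (glplus R S) (E m k).
  by apply: Defs.sub_span; exists m, k; split=> //; exact/negP.
rewrite -[E m k]/(sl_val (sl_mk (parabolic_glplus xE))).
rewrite [LHS](@act_tens1 _ _ _ (pullback (@proj_glS_hom R S) V)) /=.
by rewrite proj_glS_plus // act_0l [LHS]top0.
Qed.

Lemma Mmod_interval_hw (lam : {linear sl_type (Hfull R) -> C^o}) :
  irreducible_highest_weight (restrict_HS S lam) V ->
  exists2 v : V, v <> 0 &
    @interval_hw R r n (fun k => lam (Ediag R k)) (Mmod V) (top_vector v).
Proof.
move=> [_ [v [v0 up diag gen]]]; exists v => //; split.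
- by move=> m k; exact: Mmod_out.
- move=> m k rm mk kn; have Sm : S m by rewrite /=; lia.
  have Sk : S k by rewrite /=; lia.
  rewrite -[E m k]/(sl_val (sl_mk (mem_glS Sm Sk))) Mmod_glS up.
    exact: top0.
  by apply: Defs.sub_span; exists m, k.
- move=> k Sk; have hE : sl_set (HS R S) (E k k) by apply: Defs.sub_span; exists k, k.
  have := diag (sl_mk hE) => /(congr1 top_vector).
  rewrite -Mmod_glS /= => ->.
  rewrite topZ; congr (_ *: _); congr (lam _).
  exact: sl_val_inj.
- move=> N Nv; apply: induced_generated => x.
  (* This gl_S-submodule contains the generator [v], hence all of [V], and the top vectors generate
     the induced module. *)
  pose P : set V := [set x | sm_set N (top_vector x)].
  have PS : is_subspace P.
    split=> [|a y z Ny Nz]; rewrite /P /=; first by rewrite top0; exact: (sm_subspace N).1.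
    by rewrite top_linear; exact: (sm_subspace N).2.
  have Pact y z : P z -> P (act y z).
    by rewrite /P /= -Mmod_glS => Nz; exact: sm_act.
  exact: (submodule_full (N := Submodule PS Pact) gen Nv).
Qed.

End HighestWeight.

(** * Integrability of L(S, lambda) *)

Lemma in_Cint_Lmod (R : realType) (r n : int)
    (lam : {linear sl_type (Hfull R) -> R[i]^o}) :
  let S := [set m : int | r <= m <= n] in
  r < n -> supp lam `<=` S -> Pplus S lam ->
  forall V : lieModule (sl_alg (glS R S)),
    irreducible_highest_weight (restrict_HS S lam) V -> in_Cint (Lmod V).
Proof.
move=> S rn _ [/choice[l lE] lout lmono] V /Mmod_interval_hw[v v0 hwv].
have ldec (i j : int) : r <= i -> i < j -> j <= n -> (l j <= l i)%N.
  by move=> ri ij jn; have := lmono i j; rewrite !lE ler_nat; apply; rewrite // /S /=; lia.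
have lE' : (fun k => lam (Ediag R k)) = (fun k => (l k)%:R) by apply/funext.
rewrite lE' in hwv; have hwq N := interval_hw_quot N hwv.
rewrite /Lmod /irr_quotient; case: pselect => [h|nirr].
  apply: (interval_hw_in_Cint (ltW rn) ldec (hwq _)); left; exact: projT2 (cid h).
(* In the default branch of [irr_quotient] the top vector must be 0, since a nonzero one would yield
   an irreducible quotient. *)
apply: (interval_hw_in_Cint (ltW rn) ldec (hwq _)); right.
have [D [d [Dv dec]]] := interval_hw_dec hwv.
have [v0E|/eqP v0n] := eqVneq (top_vector v) 0; first by rewrite v0E.
by case: nirr; exact: irreducible_quotient_exists Dv (hw_gen hwv) dec v0n.
Qed.

(** * Submodules as modules *)

Section SubmoduleType.
Variables (K : fieldType) (g : lieAlgType K) (M : lieModule g) (N : submodule M).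

Definition smod_pred : {pred M} := fun x => `[< sm_set N x >].

Fact smod_pred_closed : subsemimod_closed smod_pred.
Proof.
have NS := sm_subspace N.
split; first split; first exact/asboolP/NS.1.
- by move=> x y /asboolP Nx /asboolP Ny; apply/asboolP/(subspaceD NS).
- by move=> a x /asboolP Nx; apply/asboolP/(subspaceZ _ NS).
Qed.

HB.instance Definition _ := GRing.isSubmodClosed.Build K M smod_pred smod_pred_closed.

Record smod_type := SmodType { smod_val : M; smod_valP : smod_val \in smod_pred }.

HB.instance Definition _ := [isSub for smod_val].
HB.instance Definition _ := [Choice of smod_type by <:].
HB.instance Definition _ := [SubChoice_isSubLmodule of smod_type by <:].

Lemma smod_mem (x : smod_type) : sm_set N (smod_val x).
Proof. exact/asboolP/smod_valP. Qed.

Definition smod_mk x (Nx : sm_set N x) : smod_type := SmodType (introT (asboolP _) Nx).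

Lemma smod_val_inj : injective smod_val. Proof. exact: val_inj. Qed.

Lemma smod_val_linear a x y : smod_val (a *: x + y) = a *: smod_val x + smod_val y.
Proof. exact: (linearP val). Qed.

Lemma smod_valZ a x : smod_val (a *: x) = a *: smod_val x.
Proof.
have v0 : smod_val 0 = 0 by exact: (raddf0 val).
by rewrite -[a *: x]addr0 smod_val_linear v0 addr0.
Qed.

Definition smod_act (x : g) (v : smod_type) : smod_type :=
  smod_mk (sm_act x (smod_mem v)).

Definition smod_module : lieModule g.
Proof.
refine (@LieModule K g smod_type smod_act _ _ _).
- by move=> a x y v; apply: smod_val_inj; rewrite smod_val_linear /= act_linearl.
- move=> a x v w; apply: smod_val_inj; rewrite smod_val_linear.
  by rewrite -[LHS]/(act x (smod_val (a *: v + w))) smod_val_linear act_linearr.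
- move=> x y v; apply: smod_val_inj; rewrite addrC -scaleN1r smod_val_linear.
  by rewrite scaleN1r addrC -act_lie.
Defined.

End SubmoduleType.

(** * Universal property of induced modules *)

Section InducedUniversal.
Variables (K : fieldType) (g : lieAlgType K) (p : subLie g).
Variables (V : lieModule (sl_alg p)) (W : lieModule g) (f : V -> W).
Hypothesis f_linear : forall a v w, f (a *: v + w) = a *: f v + f w.
Hypothesis f_act : forall x v, f (act x v) = act (sl_val x) (f v).

Lemma uact_linear (u : envel g) a (v w : W) :
  uact u (a *: v + w) = a *: uact u v + uact u w.
Proof. exact: tact_linear. Qed.

Lemma uactDr (u : envel g) (v w : W) : uact u (v + w) = uact u v + uact u w.
Proof. by have := uact_linear u 1 v w; rewrite !scale1r. Qed.

Lemma uactDl (u u' : envel g) (v : W) : uact (u + u') v = uact u v + uact u' v.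
Proof.
by have [s ->] := upi_surj u; have [t ->] := upi_surj u'; rewrite -upiD !uactE.
Qed.

Lemma uactM (u u' : envel g) (v : W) : uact (u * u') v = uact u (uact u' v).
Proof.
by have [s ->] := upi_surj u; have [t ->] := upi_surj u'; rewrite -upiM !uactE.
Qed.

Lemma f_uact (b : envel (sl_alg p)) v : f (uact b v) = uact (uincl b) (f v).
Proof.
have fD x y : f (x + y) = f x + f y by have := f_linear 1 x y; rewrite !scale1r.
have f0 : f 0 = 0 by apply: (@addrI _ (f 0)); rewrite -fD !addr0.
have fZ a x : f (a *: x) = a *: f x.
  by have := f_linear a x 0; rewrite f0 !addr0.
have [t ->] := upi_surj b; rewrite uinclE !uactE.
elim: t v => //= s IHs t IHt v; first by rewrite fD IHs IHt.
by rewrite IHs IHt.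
Qed.

Fixpoint tterm_eval (t : tterm (envel g) V) : W :=
  match t with
  | TTens u v => uact u (f v)
  | TZero => 0
  | TAdd s t => tterm_eval s + tterm_eval t
  | TOpp s => - tterm_eval s
  end.

Lemma tterm_eval_eqv s t : teqv s t -> tterm_eval s = tterm_eval t.
Proof.
elim=> //= {s t}; try by move=> *; congruence.
- by move=> s t u; rewrite addrA.
- by move=> s t; rewrite addrC.
- by move=> t; rewrite add0r.
- by move=> t; rewrite addNr.
- by move=> u u' v; rewrite uactDl.
- by move=> u v v'; rewrite -[v]scale1r f_linear !scale1r uactDr.
- by move=> u b v; rewrite f_uact uactM.
Qed.

(** Frobenius reciprocity: [tens u v] goes to [u (f v)]. Compatibility with moving U(p) across the
    tensor is [f_uact]. *)
Lemma induced_universal : exists2 phi : induced_module V -> W,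
  is_hom phi & forall v, phi (tens 1 v) = f v.
Proof.
pose phi (m : induced V) : W := tterm_eval (repr m).
have phiE t : phi (tpi t) = tterm_eval t by exact/tterm_eval_eqv/reprT.
have phiD m m' : phi (m + m') = phi m + phi m'.
  have [s ->] := tpi_surj m; have [t ->] := tpi_surj m'.
  by rewrite -tpi_add !phiE.
have phiM u m : phi (lmul u m) = uact u (phi m).
  have [t ->] := tpi_surj m; rewrite lmulE !phiE.
  have u0 : uact u (0 : W) = 0.
    by have := uact_linear u (-1) 0 0; rewrite scaler0 addr0 scaleN1r addNr.
  elim: t => /= [u' v||s IHs t IHt|s IHs]; first by rewrite uactM.
  - by rewrite u0.
  - by rewrite uactDr IHs IHt.
  - by have := uact_linear u (-1) (tterm_eval s) 0; rewrite u0 !addr0 !scaleN1r IHs.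
exists phi; first split.
- move=> a m m'; rewrite phiD; congr (_ + _).
  by rewrite [LHS]phiM -upi_scal uactE.
- by move=> x m; rewrite [LHS]phiM uactE.
- by move=> v; rewrite phiE /= -[1]scale1r -upi_scal uactE /= scale1r.
Qed.

End InducedUniversal.

(** * Homomorphisms into an irreducible module *)

Section IrreducibleHom.
Variables (K : fieldType) (g : lieAlgType K) (M W : lieModule g) (phi : M -> W).
Hypothesis hom_phi : is_hom phi.

Lemma hom0 : phi 0 = 0.
Proof. by have := hom_phi.1 (-1) 0 0; rewrite scaler0 addr0 scaleN1r addNr. Qed.

Lemma homB x y : phi (x - y) = phi x - phi y.
Proof. by rewrite addrC -scaleN1r hom_phi.1 scaleN1r addrC. Qed.

Lemma ker_submodule : exists N : submodule M, sm_set N = [set x | phi x = 0].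
Proof.
unshelve eexists (@Submodule K g M [set x | phi x = 0] _ _) => //.
  split=> [|a x y /= px py]; first exact: hom0.
  by rewrite hom_phi.1 px py scaler0 addr0.
by move=> x y /= py; rewrite hom_phi.2 py act0.
Qed.

Lemma hom_image_full (N : submodule M) x : irreducible W -> sm_set N x ->
  phi x <> 0 -> forall w, exists2 y, sm_set N y & phi y = w.
Proof.
move=> [_ irr] Nx px w; pose P := [set w | exists2 y, sm_set N y & phi y = w].
have [N0 NN] := sm_subspace N.
have PS : is_subspace P.
  split=> [|a _ _ [y Ny <-] [z Nz <-]]; first by exists 0 => //; exact: hom0.
  by exists (a *: y + z); [exact: NN|rewrite hom_phi.1].
have Pact y z : P z -> P (act y z).
  by move=> [t Nt <-]; exists (act y t); [exact: sm_act|rewrite hom_phi.2].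
have [/= P0|/= PT] := irr (Submodule PS Pact); last by have : P w by rewrite PT.
case: px; have : P (phi x) by exists x.
by rewrite P0.
Qed.

Lemma hom_surjective x : irreducible W -> phi x <> 0 ->
  forall w, exists y, phi y = w.
Proof.
move=> irr px w; pose T := @Submodule K g M setT
  (conj I (fun _ _ _ _ _ => I)) (fun _ _ _ => I).
by have [y _ yw] := hom_image_full (N := T) irr I px w; exists y.
Qed.

(** The first isomorphism theorem, with the map leaving [W] through a chosen section of [phi], which
    is a homomorphism modulo the kernel. *)
Lemma isomorphic_quot (N : submodule M) :
  sm_set N = [set x | phi x = 0] -> (forall w, exists x, phi x = w) ->
  isomorphic W (quot_module N).
Proof.
move=> NE sphi; have [s sK] := choice sphi.
have pq x y : phi x = phi y -> qpi N x = qpi N y.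
  by move=> xy; apply/(qpiP N x y); rewrite NE /= homB xy subrr.
exists (fun w => qpi N (s w)).
  split=> [a v w|x v].
    by rewrite -qpi_linear; apply: pq; rewrite hom_phi.1 !sK.
  by rewrite -(qpi_hom N).2; apply: pq; rewrite hom_phi.2 !sK.
have reprK' x : phi (repr (qpi N x)) = phi x.
  have : sm_set N (repr (qpi N x) - x) by exact: reprQ.
  by rewrite NE /= homB => /eqP; rewrite subr_eq0 => /eqP.
exists (fun u : quot N => phi (repr u)) => [w|u]; first by rewrite reprK' sK.
by have [x ->] := qpi_surj u; rewrite reprK'; apply: pq; rewrite sK.
Qed.

End IrreducibleHom.

(** * Irreducible integrable modules *)

Section HighestWeightVectors.
Variable R : realType.
Local Notation C := R[i].
Local Notation gl := (glinf R).
Local Notation E := (Emat R).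
Variable W : lieModule gl.

Definition killed_by (P : int -> int -> Prop) (v : W) : Prop :=
  forall m k, P m k -> act (E m k) v = 0.

(** Take the last nonzero vector among the powers of [E_{m0,k0}] on [v]. The closure hypothesis puts
    the commutators back into [P], so [P] kills all these powers. *)
Lemma killed_by_extend (P : int -> int -> Prop) m0 k0 :
  acts_locally_nilpotently W (E m0 k0) ->
  (forall m k, P m k -> (k = m0 -> P m k0) /\ (m = k0 -> P m0 k)) ->
  (exists2 v, v <> 0 & killed_by P v) ->
  exists2 v, v <> 0 & killed_by (fun m k => P m k \/ m = m0 /\ k = k0) v.
Proof.
move=> nil Pcl [v v0 kv]; have [l0 l0v] := nil v.
have kiter t : killed_by P (iter t (act (E m0 k0)) v).
  elim: t => [//|t IH] m k Pmk; have [P1 P2] := Pcl m k Pmk.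
  rewrite iterS act_comm IH // act0 add0r lieEE.
  rewrite -scaleN1r addrC !act_linearl !actZl.
  have [e1|_] := eqVneq k m0; have [e2|_] := eqVneq m k0;
    rewrite ?scale0r ?scaler0 ?add0r ?IH ?scaler0 ?addr0 //; by [exact: P1|exact: P2].
have [] := @ex_minnP (fun l => iter l (act (E m0 k0)) v == 0)
  (ex_intro _ l0 (introT eqP l0v)).
move=> [|l] /eqP lv lmin; first by case: v0.
exists (iter l (act (E m0 k0)) v).
  by move=> /eqP/lmin; rewrite ltnn.
by move=> m k [/kiter//|[-> ->]].
Qed.

Hypothesis nil : forall p q, p != q -> acts_locally_nilpotently W (E p q).
Variables r n : int.

(* The columns of the strictly upper triangular matrices are treated from the
   last one backwards, so that commutators fall into columns already killed. *)
Lemma killed_by_upper :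
  (exists2 v : W, v <> 0 & killed_by (fun _ k => ~~ (r <= k <= n)) v) ->
  exists2 v : W, v <> 0 &
    killed_by (fun m k => ~~ (r <= k <= n) \/ [/\ r <= m, m < k & k <= n]) v.
Proof.
move=> start.
(* After [t] rounds the columns [k > n - t] are done. *)
have cols (t : nat) : exists2 v : W, v <> 0 & killed_by (fun m k =>
    ~~ (r <= k <= n) \/ [/\ r <= m, m < k, k <= n & n < k + t%:Z]) v.
  elim: t => [|t IHt].
    case: start => v v0 kv; exists v => // m k [/kv//|[*]]; lia.
  (* Within the column [n - t] the first [u] rows, starting at [r], are done. *)
  have rows (u : nat) : exists2 v : W, v <> 0 & killed_by (fun m k =>
      (~~ (r <= k <= n) \/ [/\ r <= m, m < k, k <= n & n < k + t%:Z]) \/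
      [/\ k + t%:Z = n, r <= m, m < k & m < r + u%:Z]) v.
    elim: u => [|u IHu].
      case: IHt => v v0 kv; exists v => // m k [/kv//|[*]]; lia.
    have [ru|ru] := ltP (r + u%:Z) (n - t%:Z).
      have [||v v0 kv] := @killed_by_extend _ (r + u%:Z) (n - t%:Z) _ _ IHu.
      - by apply: nil; apply/eqP; lia.
      - move=> m k [[kI|[]]|[]].
        + by split=> ?; [lia|left; left].
        + by split=> ?; [lia|left; right; split; lia].
        + by split=> ?; lia.
      exists v => // m k mk; apply: kv; case: mk => [|[*]]; first by left; left.
      have [->|?] := eqVneq m (r + u%:Z); first by right; split; lia.
      by left; right; split; lia.
    case: IHu => v v0 kv; exists v => // m k [|[*]]; first by move=> ?; apply: kv; left.
    by apply: kv; right; split; lia.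
  have [v v0 kv] := rows (absz (n - r)%R).
  exists v => // m k [?|[*]]; apply: kv; first by left; left.
  have [?|?] := eqVneq (k + t%:Z) n; first by right; split; lia.
  by left; right; split; lia.
have [v v0 kv] := cols (absz (n - r)%R).+1.
exists v => // m k [?|[*]]; apply: kv; first by left.
by right; split; lia.
Qed.

(** Diagonal units commute with each other and rescale every matrix unit, so [E_{q,q}] preserves the
    vectors killed by [P] with given eigenvalues on [s]; an eigenvector is found there, one index at
    a time. *)
Lemma killed_by_eigenvector (P : int -> int -> Prop) (s : seq int) :
  (forall k, acts_semisimply W (E k k)) ->
  (exists2 v : W, v <> 0 & killed_by P v) ->
  exists v : W, [/\ v <> 0, killed_by P v &
    forall k, k \in s -> exists a : C, act (E k k) v = a *: v].
Proof.
move=> ss start; elim: s => [|q s [v [v0 kv sv]]].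
  by have [v v0 kv] := start; exists v.
have [a av] : exists a : int -> C, forall k, k \in s -> act (E k k) v = a k *: v.
  have /choice[a av] : forall k, exists b : C, k \in s -> act (E k k) v = b *: v.
    by move=> k; have [/sv[b bv]|_] := boolP (k \in s); [exists b|exists 0].
  by exists a.
pose N := [set x : W | killed_by P x /\ forall k, k \in s -> act (E k k) x = a k *: x].
have NS : is_subspace N.
  split=> [|b x y [kx ax] [ky ay]].
    by split=> [m k _|k _]; rewrite act0 ?scaler0.
  split=> [m k mk|k ks]; first by rewrite act_linearr kx // ky // scaler0 addr0.
  by rewrite act_linearr ax // ay // scalerDr !scalerA mulrC.
have NE x : N x -> N (act (E q q) x).
  move=> [kx ax]; split=> [m k mk|k ks].
    rewrite act_comm kx // act0 add0r lie_antisym lie_diag -scaleN1r !actZl.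
    by rewrite kx // !scaler0.
  by rewrite act_comm ax // actZr lie_diag subrr scale0r act_0l addr0.
have [x [[kx ax] x0 [b bx]]] := eigenvector_in_subspace NS NE (conj kv av) v0 (ss q v).
exists x; split=> // k; rewrite inE => /predU1P[->|ks]; first by exists b.
by exists (a k); exact: ax.
Qed.

End HighestWeightVectors.

Section IntegrableHighestWeight.
Variable R : realType.
Local Notation C := R[i].
Local Notation gl := (glinf R).
Local Notation E := (Emat R).

Lemma finite_set_interval (T : set int) : finite_set T ->
  exists r n : int, r < n /\ T `<=` [set k : int | r <= k <= n].
Proof.
move=> /finite_seqP[s ->]; elim: s => [|a s [r [n [rn sT]]]]; first by exists 0, 1.
exists (Num.min r a), (Num.max n a); split; first by lia.
move=> k /=; rewrite inE => /predU1P[->|/sT/=]; lia.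
Qed.

Lemma irreducible_interval_hw (W : lieModule gl) : irreducible W -> in_Cint W ->
  exists (r n : int) (v : W) (l : int -> nat), [/\ r < n, v <> 0,
    interval_hw r n (fun k => (l k)%:R) v &
    forall i j : int, r <= i -> i < j -> j <= n -> (l j <= l i)%N].
Proof.
move=> irr [inC [ss nil]]; have [w0 w0n] := irr.1.
have [T Tf Tw] := inC w0; have [r [n [rn TS]]] := finite_set_interval Tf.
have [s _ sE] := interval_seq r n; exists r, n.
have start : exists2 v : W, v <> 0 & killed_by (fun _ k => ~~ (r <= k <= n)) v.
  by exists w0 => // m k kI; apply: Tw => /TS /=; rewrite (negPf kI).
have [v [v0 kv sv]] := killed_by_eigenvector s ss (killed_by_upper nil start).
have out (m k : int) : ~~ (r <= k <= n) -> act (E m k) v = 0.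
  by move=> kI; apply: kv; left.
have up (m k : int) : r <= m -> m < k -> k <= n -> act (E m k) v = 0.
  by move=> *; apply: kv; right.
have nat_diff (i j : int) (c : C) : i != j -> act (E i j) v = 0 ->
    act (E i i - E j j) v = c *: v -> exists a : nat, c = a%:R.
  move=> ij ijv cv; apply: (sl2_weight_nat (lie_sl2_ef R i j) (lie_sl2_hf R ij) ijv cv v0).
  by apply: nil; rewrite eq_sym.
have actB' (x y : gl) : act (x - y) v = act x v - act y v.
  by rewrite addrC -scaleN1r act_linearl scaleN1r addrC.
have /choice[l lE] : forall k : int, exists a : nat, r <= k <= n ->
    act (E k k) v = (a%:R : C) *: v.
  move=> k; have [kI|_] := boolP (r <= k <= n); last by exists 0%N.
  have [c cv] : exists c : C, act (E k k) v = c *: v by apply: sv; rewrite sE.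
  (* The index [n + 1] lies outside the interval and [E_{n+1,n+1}] kills [v], so the sl_2-weight for
     [k] and [n + 1] is [c] itself. *)
  have [a ca] : exists a : nat, c = a%:R.
    have kn : ~~ (r <= n + 1 <= n) by lia.
    apply: (nat_diff k (n + 1)); [by apply/eqP; lia|exact: out|].
    by rewrite actB' [act (E (n + 1) _) v]out // subr0.
  by exists a => _; rewrite cv ca.
exists v, l; split=> //.
  by split=> //; exact: irreducible_generated.
move=> i j ri ij jn; have [a aE] : exists a : nat, (l i)%:R - (l j)%:R = a%:R :> C.
  apply: (nat_diff i j); [by apply/eqP; lia|exact: up|].
  by rewrite actB' !lE ?scalerBl //; lia.
by rewrite -(ler_nat C) -subr_ge0 aE ler0n.
Qed.

End IntegrableHighestWeight.

(** * Weights in H* with prescribed values on a finite set *)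

Section DiagonalFunctional.
Variables (R : realType) (s : seq int) (l : int -> R[i]).

Definition diag_functional (x : sl_type (Hfull R)) : R[i]^o :=
  \sum_(k <- s) l k * sl_val x k k.

Fact diag_functional_linear : linear diag_functional.
Proof.
move=> a x y; rewrite /diag_functional scaler_sumr -big_split; apply: eq_bigr => k _.
by rewrite sl_valD glDE glZE mulrDr mulrCA.
Qed.

HB.instance Definition _ := GRing.isLinear.Build R[i] (sl_type (Hfull R)) R[i]^o _
  diag_functional diag_functional_linear.

Lemma diag_functional_Ediag k : uniq s ->
  diag_functional (Ediag R k) = if k \in s then l k else 0.
Proof.
move=> us; rewrite /diag_functional /=; case: ifPn => ks.
  rewrite (bigD1_seq k) //= eqxx mulr1 big1 ?addr0 // => p /negPf->.
  by rewrite mulr0.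
rewrite big_seq big1 // => p ps; case: eqVneq ps ks => [->->//|_ _ _].
by rewrite mulr0.
Qed.

End DiagonalFunctional.

(** * Realization of an irreducible module as L(S, lambda) *)

Section Realization.
Variables (R : realType) (r n : int).
Local Notation C := R[i].
Local Notation gl := (glinf R).
Local Notation E := (Emat R).
Local Notation S := [set m : int | r <= m <= n].
Local Notation glS := (glS R S).
Variables (W : lieModule gl) (l : int -> C) (v : W).
Hypothesis irrW : irreducible W.
Hypothesis hwv : interval_hw r n l v.
Hypothesis v0 : v <> 0.

Let WS : lieModule (sl_alg glS) := pullback (@sl_val_hom _ _ glS) W.

(** The gl_S-submodule of [W] generated by [v], the model of L(lambda_S). *)
Definition glS_span : set W :=
  [set x | forall N : submodule WS, sm_set N v -> sm_set N x].

Fact glS_span_subspace : is_subspace glS_span.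
Proof.
split=> [N _|a x y gx gy N Nv]; first exact: (sm_subspace N).1.
by apply: (sm_subspace N).2; [exact: gx|exact: gy].
Qed.

Fact glS_span_act (x : sl_alg glS) (y : WS) : glS_span y -> glS_span (act x y).
Proof. by move=> gy N Nv; apply: (@sm_act _ _ WS); exact: gy. Qed.

Definition top_submodule : submodule WS :=
  @Submodule _ _ WS glS_span glS_span_subspace glS_span_act.

Definition top_module : lieModule (sl_alg glS) := smod_module top_submodule.

Lemma top_mem (x : top_module) : glS_span (smod_val x).
Proof. exact: (@smod_mem _ _ WS top_submodule x). Qed.

Lemma glS_span_v : glS_span v. Proof. by move=> N. Qed.

Definition top_generator : top_module :=
  @smod_mk _ _ WS top_submodule v glS_span_v.

Lemma espan_act (Q : int -> int -> Prop) (P : set W) : is_subspace P ->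
  forall x y, (forall m k, Q m k -> P (act (E m k) y)) -> espan Q x -> P (act x y).
Proof.
move=> PS x y PE Qx; apply: (Qx [set x | P (act x y)]) => [|_ [m [k [mk ->]]]].
  2: exact: PE.
split=> [|a z t Pz Pt] /=; first by rewrite act_0l; exact: PS.1.
by rewrite act_linearl; apply: PS.2.
Qed.

Lemma glS_span_ind (P : set W) : is_subspace P -> P v ->
  (forall m k x, S m -> S k -> P x -> P (act (E m k) x)) -> glS_span `<=` P.
Proof.
move=> PS Pv PE x.
have Pact (y : sl_alg glS) (z : WS) : P z -> P (act y z).
  move=> Pz; apply: (espan_act PS _ (sl_mem y)) => m k [Sm Sk]; exact: PE.
by move=> /(_ (@Submodule _ _ WS P PS Pact) Pv).
Qed.

(** Bracketing [E_{m,k}] with a unit of gl_S leaves the column [k] unchanged, so annihilation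
    spreads from [v]. *)
Lemma glS_span_out m k x : ~ S k -> glS_span x -> act (E m k) x = 0.
Proof.
move=> nS gx.
apply: (@glS_span_ind [set x | forall m k, ~ S k -> act (E m k) x = 0]) => //.
- split=> [p q _|a y z y0 z0 p q nq]; first by rewrite act0.
  by rewrite act_linearr y0 // z0 // scaler0 addr0.
- by move=> p q nq; apply: (hw_out hwv); exact/negP.
- move=> p q y Sp Sq y0 p' q' nq'; rewrite act_comm y0 // act0 add0r lieEE.
  have -> : (q' == p) = false by apply/eqP => q'p; apply: nq'; rewrite q'p.
  by rewrite scale0r sub0r -scaleN1r !actZl y0 // !scaler0.
Qed.

Lemma top_generated (N : submodule top_module) :
  sm_set N top_generator -> sm_set N = setT.
Proof.
move=> Nv; apply/seteqP; split=> // x _.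
pose P : set W := [set y | exists2 z, sm_set N z & smod_val z = y].
have PS : is_subspace P.
  split=> [|a _ _ [y Ny <-] [z Nz <-]]; first by exists 0 => //; exact: (sm_subspace N).1.
  by exists (a *: y + z); [exact: (sm_subspace N).2|rewrite smod_val_linear].
have Pact (y : sl_alg glS) (z : WS) : P z -> P (act y z).
  by move=> [t Nt <-]; exists (act y t) => //; exact: sm_act.
have [z Nz /smod_val_inj <- //] : P (smod_val x).
have /(_ (@Submodule _ _ WS P PS Pact)) := top_mem x; apply.
by exists top_generator.
Qed.

(** A nonzero gl_S-submodule [N] generates [W], yet by [parabolic_cone] it only generates [N] plus
    lower degrees. So [v], of top degree, lies in [N]. *)
Lemma top_irreducible : irreducible top_module.
Proof.
split; first by exists top_generator => /(congr1 (@smod_val _ _ _ _)).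
move=> N; have [[x [Nx x0]]|N0] := pselect (exists x, sm_set N x /\ x <> 0); last first.
  left; apply/seteqP; split=> [x Nx|_ ->]; last exact: (sm_subspace N).1.
  by apply: contrapT => x0; apply: N0; exists x.
right; apply: top_generated.
have [s us sE] := interval_seq r n.
(* With weight 1 on S and 0 elsewhere, gl_S has degree 0 and its whole span of [v] is in one
   degree. *)
pose w (k : int) : nat := r <= k <= n.
have ws k : w k != 0%N -> k \in s by rewrite /w sE; case: (r <= k <= n).
pose D := weight_diag R w s.
have [d Dv] : exists d : C, act D v = d *: v.
  exists (\sum_(k <- s) l k); rewrite act_suml scaler_suml big_seq [RHS]big_seq.
  apply: eq_bigr => k; rewrite sE => kI; rewrite /w kI scale1r.
  exact: hw_diag hwv _ kI.
have Dg y : glS_span y -> act D y = d *: y.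
  apply: (@glS_span_ind [set y | act D y = d *: y]) => //.
    split=> [|a y' z Dy Dz] /=; first by rewrite act0 scaler0.
    by rewrite act_linearr Dy Dz scalerDr !scalerA mulrC.
  move=> m k y' Sm Sk Dy /=.
  have DE : lie D (E m k) = 0 *: E m k.
    by rewrite lie_weight_diag // /w Sm Sk subrr.
  by rewrite (act_eigen Dy DE) addr0.
pose X : set W := [set y | exists2 z, sm_set N z & smod_val z = y].
have XS : is_subspace X.
  split=> [|a _ _ [y Ny <-] [z Nz <-]]; first by exists 0 => //; exact: (sm_subspace N).1.
  by exists (a *: y + z); [exact: (sm_subspace N).2|rewrite smod_val_linear].
have [_ [y _ <-]|m k _ km [y Ny <-]|N' [XN NX]] := parabolic_cone us ws (d := d) XS.
- exact/Dg/top_mem.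
- have [Sk|nSk] := pselect (S k).
    have Sm : S m by move: km; rewrite /w /= Sk; case: (r <= m <= n).
    by exists (act (sl_mk (mem_glS Sm Sk) : sl_alg glS) y) => //; exact: sm_act.
  by rewrite glS_span_out //; [exact: XS.1|exact: top_mem].
have NT : sm_set N' = setT.
  have xn : (smod_val x : W) <> 0 by move=> xE; apply: x0; exact: smod_val_inj.
  by apply: (irreducible_generated irrW xn); apply: XN; exists x.
have [y [b [[z Nz zy] bb vE]]] : sum_sub X (below D d) v by apply: NX; rewrite NT.
suff b0 : b = 0.
  suff -> : top_generator = z by [].
  by apply: smod_val_inj; rewrite zy /= vE b0 addr0.
apply: (below_eigen0 _ bb); have -> : b = v - y by rewrite vE addrC addKr.
by apply: Dg; apply: (subspaceB glS_span_subspace glS_span_v); rewrite -zy; exact: top_mem.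
Qed.

Variables (s : seq int) (us : uniq s) (sE : forall k : int, (k \in s) = (r <= k <= n)).

Lemma top_highest_weight :
  irreducible_highest_weight
    (restrict_HS S (diag_functional s l : {linear _ -> _})) top_module.
Proof.
split; first exact: top_irreducible.
exists top_generator; split; last exact: top_generated.
- by move=> /(congr1 (@smod_val _ _ _ _)).
- move=> x xp; apply: smod_val_inj => /=.
  apply: (@espan_act _ [set 0 : W] _ (sl_val x) v _ xp).
    by split=> // a y z -> ->; rewrite scaler0 addr0.
  by move=> m k [/= /andP[rm _] /andP[_ kn] mk]; apply: (hw_up hwv).
- move=> h; apply: smod_val_inj; rewrite [RHS]smod_valZ.
  pose N := [set y : gl | act y v = (\sum_(k <- s) l k * y k k) *: v].
  suff : N (sl_val h) by [].
  apply: (sl_mem h) => [|_ [m [_ [[<- Sm] ->]]]].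
    split=> [|a y z Ny Nz]; rewrite /N /=.
      by rewrite act_0l big1 ?scale0r // => k _; rewrite mulr0.
    rewrite act_linearl Ny Nz scalerA -scalerDl mulr_sumr -big_split /=.
    congr (_ *: _); apply: eq_bigr => k _.
    by rewrite mul1r addr0 mulrDr mulrCA.
  rewrite /N /= (hw_diag hwv) // (bigD1_seq m) ?sE //= eqxx mulr1.
  by rewrite big1 ?addr0 // => p /negPf->; rewrite mulr0.
Qed.

(** The inclusion into [W] is linear over the parabolic subalgebra because gl_oo^(S,+) kills the top
    part, hence it extends to the induced module. *)
Lemma top_module_quotient : exists2 phi : Mmod top_module -> W,
  is_hom phi & forall x, phi (top_vector x) = smod_val x.
Proof.
apply: (@induced_universal _ _ _ (pullback (@proj_glS_hom R S) top_module) W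
  (fun x : top_module => smod_val x : W)); first exact: smod_val_linear.
move=> x y; have [z [t [zp tS xE]]] := sl_mem x.
pose zx : sl_alg (parabolic R S) := sl_mk (parabolic_glplus zp).
pose tx : sl_alg (parabolic R S) := sl_mk (parabolic_glS tS).
have -> : smod_val (act x y) = act (sl_val (proj_glS x)) (smod_val y : W) by [].
have -> : sl_val (proj_glS x) = t.
  have -> : x = 1 *: zx + tx by apply: sl_val_inj; rewrite sl_valD scale1r.
  rewrite (@proj_glS_hom R S).1 proj_glS_plus // scaler0 add0r.
  exact: proj_glS_id.
rewrite xE actDl (_ : act z _ = 0) ?add0r //.
apply: (@espan_act _ [set 0 : W] _ z (smod_val y) _ zp).
  by split=> // a y' z' -> ->; rewrite scaler0 addr0.
by move=> m k nS; apply: (glS_span_out _ nS); exact: top_mem.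
Qed.

(** The kernel of [phi] is the submodule [N] defining the irreducible quotient: it avoids the top
    vector, so it lies in [N], and the converse uses irreducibility of [W]. *)
Lemma top_module_realizes : isomorphic W (Lmod top_module).
Proof.
have [phi hom_phi phiE] := top_module_quotient.
have [v1 v1n hw1] := Mmod_interval_hw top_highest_weight.
have [D [d [Dv dec]]] := interval_hw_dec hw1.
have phi1 : phi (top_vector v1) <> 0.
  by rewrite phiE => v1E; apply: v1n; exact: smod_val_inj.
have top1 : top_vector v1 <> 0 by move=> t0; apply: phi1; rewrite t0 hom0.
rewrite /Lmod /irr_quotient; case: pselect => [h|nirr]; last first.
  by case: nirr; exact: irreducible_quotient_exists Dv (hw_gen hw1) dec top1.
case: (cid h) => N irrN /=.
have [nN maxN] := irreducible_quotient_maximal Dv (hw_gen hw1) dec irrN.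
have [Ker KerE] := ker_submodule hom_phi.
have KN : sm_set Ker `<=` sm_set N by apply: maxN; rewrite KerE.
apply: (isomorphic_quot hom_phi).
  apply/seteqP; split=> [x Nx|x px]; last by apply: KN; rewrite KerE.
  (* If [phi] did not vanish on [N], it would map [N] onto [W]; then [N] would contain the top
     vector modulo the kernel, and the kernel lies in [N]. *)
  apply: contrapT => px; apply: nN.
  have [y Ny py] := hom_image_full hom_phi irrW Nx px (phi (top_vector v1)).
  rewrite -(subrK y (top_vector v1)); apply: (subspaceD (sm_subspace N)) => //.
  by apply: KN; rewrite KerE /= homB // py subrr.
exact: (hom_surjective hom_phi irrW phi1).
Qed.

End Realization.

(** Here [V] stands for any model of L(lambda_S): the first half holds for all of them, the second
    exhibits one. *)
Theorem theorem3p21 (R : realType) :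
  (forall (r n : int) (lam : {linear sl_type (Hfull R) -> R[i]^o}),
     let S := [set m : int | r <= m <= n] in
     r < n -> supp lam `<=` S -> Pplus S lam ->
     forall V : lieModule (sl_alg (glS R S)),
       irreducible_highest_weight (restrict_HS S lam) V ->
       in_Cint (Lmod V)) /\
  (forall W : lieModule (glinf R),
     irreducible W -> in_Cint W ->
     exists (r n : int) (lam : {linear sl_type (Hfull R) -> R[i]^o}),
       let S := [set m : int | r <= m <= n] in
       [/\ r < n, supp lam `<=` S, Pplus S lam &
         exists2 V : lieModule (sl_alg (glS R S)),
           irreducible_highest_weight (restrict_HS S lam) V &
           isomorphic W (Lmod V)]).
Proof.
split=> [r n lam|W irrW intW]; first exact: in_Cint_Lmod.
have [r [n [v [l [rn v0 hwv ldec]]]]] := irreducible_interval_hw irrW intW.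
have [s us sE] := interval_seq r n.
pose lam : {linear sl_type (Hfull R) -> R[i]^o} :=
  diag_functional s (fun k => (l k)%:R).
have lamE k : lam (Ediag R k) = if k \in s then (l k)%:R else 0.
  exact: diag_functional_Ediag.
exists r, n, lam; split=> //.
- by move=> k; rewrite /supp /= lamE sE; case: ifP => //; rewrite eqxx.
- split=> [k|k nS|i j Si Sj ij]; rewrite lamE ?sE.
  + by case: ifP; eexists; [reflexivity|exact: (esym (mulr0n 1))].
  + by case: ifP.
  + rewrite lamE !sE [r <= i <= n]Si [r <= j <= n]Sj ler_nat; apply: ldec => //.
      by case/andP: Si.
    by case/andP: Sj.
exists (top_module r n v); first exact: (top_highest_weight irrW hwv v0 us sE).
exact: (top_module_realizes irrW hwv v0 us sE).
Qed.
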